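(* The sectional curvature at the identity of the group $\mathcal D_{\mu,ex}(\mathbb T^2)$ of exact volume-preserving diffeomorphisms of the flat torus $\mathbb T^2=\mathbb R^2/\mathbb Z^2$, with the right-invariant $\dot H^{-1/2}$ metric, is unbounded of both signs: for every $C>0$ there exist linearly independent $u,v$ in the Lie algebra with $K(u,v)>C$, and there exist linearly independent $u',v'$ in the Lie algebra with $K(u',v')<-C$.
   Context: The Lie algebra of $\mathcal D_{\mu,ex}(\mathbb T^2)$ consists of the fields $u=\nabla^\perp f$, where $f\in C^\infty(\mathbb T^2)$ has mean zero and $\nabla^\perp$ is the $90^\circ$-rotated gradient; it is identified with the space of such stream functions. The $\dot H^{-1/2}$ inner product is $$\langle\langle\nabla^\perp f,\nabla^\perp g\rangle\rangle=\int_{\mathbb T^2}f\,(-\Delta)^{1/2}g\,d\mu,$$ where $(-\Delta)^{1/2}$ is the Fourier multiplier with symbol $\sqrt{j^2+k^2}$ at frequency $(j,k)\in(2\pi\mathbb Z)^2$; write $\|u\|^2=\langle\langle u,u\rangle\rangle$. In terms of stream functions the Lie bracket is $\mathrm{ad}_fg=\{g,f\}=\langle\nabla g,\nabla^\perp f\rangle$, and $\mathrm{ad}^*_u$ is defined by $\langle\langle\mathrm{ad}^*_uv,w\rangle\rangle=\langle\langle v,\mathrm{ad}_uw\rangle\rangle$ for all $w$. The non-normalized sectional curvature at the identity of the right-invariant metric is given by Arnold's formula $$\overline K(u,v)=\tfrac14\|\mathrm{ad}^*_vu+\mathrm{ad}^*_uv\|^2-\langle\langle\mathrm{ad}^*_uu,\mathrm{ad}^*_vv\rangle\rangle-\tfrac34\|\mathrm{ad}_uv\|^2+\tfrac12\langle\langle\mathrm{ad}_uv,\mathrm{ad}^*_vu-\mathrm{ad}^*_uv\rangle\rangle,$$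 and the sectional curvature is $K(u,v)=\overline K(u,v)/\big(\|u\|^2\|v\|^2-\langle\langle u,v\rangle\rangle^2\big)$. *)

(* Defs.v *)
(* Classical real numbers of the standard library, with Coquelicot. *)
From Stdlib Require Import Reals ZArith ClassicalEpsilon.
From Coquelicot Require Import Coquelicot.

Open Scope R_scope.

(** * Functions on the torus R^2/Z^2 *)

(* A function on the torus is a 1-periodic function of two real variables. *)
Definition periodic (f : R -> R -> R) : Prop :=
  forall x y, f (x + 1) y = f x y /\ f x (y + 1) = f x y.

(* [ex_diff_n f n x y] says that all iterated partial derivatives of [f] of
   order at most [n] exist and are jointly continuous at [(x, y)]. *)
Definition smooth (f : R -> R -> R) : Prop :=
  forall n x y, ex_diff_n f n x y.

(* The integral for the normalised measure mu, as an iterated integral over a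
   fundamental domain; every integrand below is continuous. *)
Definition torus_int (f : R -> R -> R) : R :=
  RInt (fun x => RInt (fun y => f x y) 0 1) 0 1.

Definition torus_int_C (f : R -> R -> C) : C :=
  (torus_int (fun x y => Re (f x y)), torus_int (fun x y => Im (f x y))).

(** * The Lie algebra, through stream functions *)

(* The skew gradient of [f] is represented by [f]: the mean-zero stream
   function of a field is unique. *)
Definition in_lie_algebra (f : R -> R -> R) : Prop :=
  smooth f /\ periodic f /\ torus_int f = 0.

Definition lin_indep (f g : R -> R -> R) : Prop :=
  forall a b : R, (forall x y, a * f x y + b * g x y = 0) -> a = 0 /\ b = 0.

Definition dx (f : R -> R -> R) : R -> R -> R :=
  fun x y => Derive (fun t => f t y) x.

Definition dy (f : R -> R -> R) : R -> R -> R :=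
  fun x y => Derive (fun t => f x t) y.

Definition grad (f : R -> R -> R) (x y : R) : R * R := (dx f x y, dy f x y).

(* Counterclockwise rotation. With the clockwise one, [ad] and [adstar] below
   change sign and the curvature is the same. *)
Definition perp_grad (f : R -> R -> R) (x y : R) : R * R :=
  (- dy f x y, dx f x y).

Definition dot (p q : R * R) : R := fst p * fst q + snd p * snd q.

Definition poisson (g f : R -> R -> R) : R -> R -> R :=
  fun x y => dot (grad g x y) (perp_grad f x y).

Definition ad (f g : R -> R -> R) : R -> R -> R := poisson g f.

(** * The homogeneous H^{-1/2} metric *)

Definition cis (t : R) : C := (cos t, sin t).

(* The integer pair [(m, n)] encodes the frequency [(2 pi m, 2 pi n)]. *)
Definition freq (m : Z) : R := 2 * PI * IZR m.

Definition phase (m n : Z) (x y : R) : R := freq m * x + freq n * y.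

Definition fourier_coef (f : R -> R -> R) (m n : Z) : C :=
  torus_int_C (fun x y => (RtoC (f x y) * cis (- phase m n x y))%C).

Definition symbol (m n : Z) : R := sqrt (freq m ^ 2 + freq n ^ 2).

Definition sum_Z (N : nat) (a : Z -> R) : R :=
  sum_n (fun i => a (Z.of_nat i - Z.of_nat N)%Z) (2 * N).

(* The Fourier multiplier (-Delta)^{1/2}, as the limit of the partial sums over
   the squares |m|, |n| <= N. For smooth periodic [f] the double series
   converges absolutely; the terms at (m, n) and (-m, -n) are conjugate, so
   that keeping the real part of each term does not change the sum. *)
Definition half_laplacian (f : R -> R -> R) : R -> R -> R :=
  fun x y => real (Lim_seq (fun N =>
    sum_Z N (fun m => sum_Z N (fun n =>
      Re (RtoC (symbol m n) * fourier_coef f m n * cis (phase m n x y))%C)))).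

Definition inner (f g : R -> R -> R) : R :=
  torus_int (fun x y => f x y * half_laplacian g x y).

Definition normsq (f : R -> R -> R) : R := inner f f.

(** * Curvature *)

Definition is_adstar (u v a : R -> R -> R) : Prop :=
  in_lie_algebra a /\
  forall w, in_lie_algebra w -> inner a w = inner v (ad u w).

(* For [u] and [v] in the Lie algebra, exactly one [a] satisfies
   [is_adstar u v a]. *)
Definition adstar (u v : R -> R -> R) : R -> R -> R :=
  epsilon (inhabits (fun _ _ => 0)) (is_adstar u v).

Definition fadd (f g : R -> R -> R) : R -> R -> R := fun x y => f x y + g x y.
Definition fsub (f g : R -> R -> R) : R -> R -> R := fun x y => f x y - g x y.

(* Arnold's formula. *)
Definition unnormalized_curvature (u v : R -> R -> R) : R :=
  1 / 4 * normsq (fadd (adstar v u) (adstar u v))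
  - inner (adstar u u) (adstar v v)
  - 3 / 4 * normsq (ad u v)
  + 1 / 2 * inner (ad u v) (fsub (adstar v u) (adstar u v)).

Definition sectional_curvature (u v : R -> R -> R) : R :=
  unnormalized_curvature u v / (normsq u * normsq v - inner u v ^ 2).

(* Main.v *)
(* Take u = cos(p.x) and v = cos(q.x) with frequencies p, q of equal length
   lambda. Both are eigenfunctions of (-Delta)^{1/2} for the same eigenvalue, so
   ad*_u u = ad*_v v = 0 and ad*_u v = - ad*_v u = lambda (-Delta)^{-1/2} {u, v},
   while {u, v} is a combination of the modes p + q and p - q. Arnold's formula
   gives
     K(u, v) = (p x q)^2 / lambda^2 * (lambda - 3/8 (|p + q| + |p - q|)),
   cubic under dilation of (p, q). The bracket is negative for p, q orthogonal
   and positive for (5, 0), (4, 3), since 4 sqrt 10 < 8/3 * 5.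

   The characterisation of ad* quantifies over all smooth w, so it needs the
   self-adjointness of (-Delta)^{1/2}: its partial Fourier sums are symmetric, and
   they converge uniformly because Fourier coefficients of smooth functions decay.
   Completeness of the Fourier system is avoided: ad*_u v enters the curvature
   only through its Fourier coefficients, which testing against modes determines. *)
Require Import Defs.
From Stdlib Require Import Reals ZArith Lra Lia ClassicalEpsilon FunctionalExtensionality.
From Coquelicot Require Import Coquelicot.
Open Scope R_scope.

(** * Calculus on the torus *)

Definition cont2 (f : R -> R -> R) : Prop :=
  forall x y, continuity_2d_pt f x y.

(** Regularity of a fixed finite order, on which the closure properties go by induction; [smooth] is
    the conjunction over all orders. *)
Definition class_C (n : nat) (f : R -> R -> R) : Prop :=
  forall x y, ex_diff_n f n x y.

Lemma fun2_ext (f g : R -> R -> R) : (forall x y, f x y = g x y) -> f = g.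
Proof.
intros H; apply functional_extensionality; intros x.
apply functional_extensionality; intros y; apply H.
Qed.

Lemma class_C_S n f :
  class_C (S n) f <->
  cont2 f /\ (forall x y, ex_derive (fun t => f t y) x) /\
  (forall x y, ex_derive (fun t => f x t) y) /\
  class_C n (dx f) /\ class_C n (dy f).
Proof.
split.
- intros H; repeat split; intros x y; destruct (H x y) as (H0 & H1 & H2 & H3 & H4);
    assumption.
- intros (H0 & H1 & H2 & H3 & H4) x y; repeat split; [apply H0 | apply H1 | apply H2 | apply H3 | apply H4].
Qed.

Lemma class_C_cont2 n f : class_C n f -> cont2 f.
Proof. intros H x y; specialize (H x y); destruct n; apply H. Qed.

Lemma class_C_pred n f : class_C (S n) f -> class_C n f.
Proof.
revert f; induction n as [|n IH]; intros f H.
- intros x y; split; [apply (class_C_cont2 1 f H) | exact I].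
- apply class_C_S in H; destruct H as (H0 & H1 & H2 & H3 & H4).
  apply class_C_S; repeat split; auto.
Qed.

Lemma dx_plus f g :
  (forall x y, ex_derive (fun t => f t y) x) ->
  (forall x y, ex_derive (fun t => g t y) x) ->
  dx (fun x y => f x y + g x y) = (fun x y => dx f x y + dx g x y).
Proof. intros Hf Hg; apply fun2_ext; intros x y; apply Derive_plus; auto. Qed.

Lemma dy_plus f g :
  (forall x y, ex_derive (fun t => f x t) y) ->
  (forall x y, ex_derive (fun t => g x t) y) ->
  dy (fun x y => f x y + g x y) = (fun x y => dy f x y + dy g x y).
Proof. intros Hf Hg; apply fun2_ext; intros x y; apply Derive_plus; auto. Qed.

Lemma dx_mult f g :
  (forall x y, ex_derive (fun t => f t y) x) ->
  (forall x y, ex_derive (fun t => g t y) x) ->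
  dx (fun x y => f x y * g x y) =
  (fun x y => dx f x y * g x y + f x y * dx g x y).
Proof.
intros Hf Hg; apply fun2_ext; intros x y; apply Derive_mult; auto.
Qed.

Lemma dy_mult f g :
  (forall x y, ex_derive (fun t => f x t) y) ->
  (forall x y, ex_derive (fun t => g x t) y) ->
  dy (fun x y => f x y * g x y) =
  (fun x y => dy f x y * g x y + f x y * dy g x y).
Proof.
intros Hf Hg; apply fun2_ext; intros x y; apply Derive_mult; auto.
Qed.

Lemma dx_scal c f : dx (fun x y => c * f x y) = (fun x y => c * dx f x y).
Proof. apply fun2_ext; intros x y; apply Derive_scal. Qed.

Lemma dy_scal c f : dy (fun x y => c * f x y) = (fun x y => c * dy f x y).
Proof. apply fun2_ext; intros x y; apply Derive_scal. Qed.

Lemma cont2_plus f g : cont2 f -> cont2 g -> cont2 (fun x y => f x y + g x y).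
Proof. intros Hf Hg x y; apply continuity_2d_pt_plus; auto. Qed.

Lemma cont2_mult f g : cont2 f -> cont2 g -> cont2 (fun x y => f x y * g x y).
Proof. intros Hf Hg x y; apply continuity_2d_pt_mult; auto. Qed.

Lemma cont2_const c : cont2 (fun _ _ => c).
Proof. intros x y; apply continuity_2d_pt_const. Qed.

Lemma cont2_scal c f : cont2 f -> cont2 (fun x y => c * f x y).
Proof. intros Hf; apply (cont2_mult (fun _ _ => c)); auto using cont2_const. Qed.

Lemma class_C_plus n f g :
  class_C n f -> class_C n g -> class_C n (fun x y => f x y + g x y).
Proof.
revert f g; induction n as [|n IH]; intros f g Hf Hg.
- intros x y; split; [|exact I].
  apply cont2_plus; [apply (class_C_cont2 0 f Hf) | apply (class_C_cont2 0 g Hg)].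
- apply class_C_S in Hf; destruct Hf as (Hf0 & Hf1 & Hf2 & Hf3 & Hf4).
  apply class_C_S in Hg; destruct Hg as (Hg0 & Hg1 & Hg2 & Hg3 & Hg4).
  apply class_C_S; repeat split.
  + apply cont2_plus; auto.
  + intros x y; refine (ex_derive_plus _ _ _ _ _); auto.
  + intros x y; refine (ex_derive_plus _ _ _ _ _); auto.
  + rewrite dx_plus; auto.
  + rewrite dy_plus; auto.
Qed.

Lemma class_C_mult n f g :
  class_C n f -> class_C n g -> class_C n (fun x y => f x y * g x y).
Proof.
revert f g; induction n as [|n IH]; intros f g Hf Hg.
- intros x y; split; [|exact I].
  apply cont2_mult; [apply (class_C_cont2 0 f Hf) | apply (class_C_cont2 0 g Hg)].
(* The Leibniz rule pairs a derivative of one factor with the other factor itself, which is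
   therefore needed at the lower order. *)
- pose proof (class_C_pred _ _ Hf) as Hf'; pose proof (class_C_pred _ _ Hg) as Hg'.
  apply class_C_S in Hf; destruct Hf as (Hf0 & Hf1 & Hf2 & Hf3 & Hf4).
  apply class_C_S in Hg; destruct Hg as (Hg0 & Hg1 & Hg2 & Hg3 & Hg4).
  apply class_C_S; repeat split.
  + apply cont2_mult; auto.
  + intros x y; apply ex_derive_mult; auto.
  + intros x y; apply ex_derive_mult; auto.
  + rewrite dx_mult; auto; apply class_C_plus; auto.
  + rewrite dy_mult; auto; apply class_C_plus; auto.
Qed.

Lemma class_C_const n c : class_C n (fun _ _ => c).
Proof.
revert c; induction n as [|n IH]; intros c.
- intros x y; split; [apply cont2_const | exact I].
- apply class_C_S; repeat split.
  + apply cont2_const.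
  + intros x y; apply ex_derive_const.
  + intros x y; apply ex_derive_const.
  + replace (dx (fun _ _ => c)) with (fun _ _ : R => 0); auto.
    apply fun2_ext; intros x y; symmetry; exact (Derive_const c _).
  + replace (dy (fun _ _ => c)) with (fun _ _ : R => 0); auto.
    apply fun2_ext; intros x y; symmetry; exact (Derive_const c _).
Qed.

(** * Smooth and periodic functions *)

Lemma smooth_class_C f : smooth f <-> forall n, class_C n f.
Proof. split; intros H n x y; apply H. Qed.

Lemma smooth_cont2 f : smooth f -> cont2 f.
Proof. intros H; apply (class_C_cont2 0), smooth_class_C, H. Qed.

Lemma smooth_ex_dx f : smooth f -> forall x y, ex_derive (fun t => f t y) x.
Proof. intros H x y; apply (H 1%nat x y). Qed.

Lemma smooth_ex_dy f : smooth f -> forall x y, ex_derive (fun t => f x t) y.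
Proof. intros H x y; apply (H 1%nat x y). Qed.

Lemma smooth_dx f : smooth f -> smooth (dx f).
Proof. intros H n x y; apply (H (S n) x y). Qed.

Lemma smooth_dy f : smooth f -> smooth (dy f).
Proof. intros H n x y; apply (H (S n) x y). Qed.

Lemma smooth_plus f g : smooth f -> smooth g -> smooth (fun x y => f x y + g x y).
Proof.
intros Hf Hg; apply smooth_class_C; intros n.
apply class_C_plus; apply smooth_class_C; auto.
Qed.

Lemma smooth_mult f g : smooth f -> smooth g -> smooth (fun x y => f x y * g x y).
Proof.
intros Hf Hg; apply smooth_class_C; intros n.
apply class_C_mult; apply smooth_class_C; auto.
Qed.

Lemma smooth_const c : smooth (fun _ _ => c).
Proof. apply smooth_class_C; intros n; apply class_C_const. Qed.

Lemma smooth_scal c f : smooth f -> smooth (fun x y => c * f x y).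
Proof. apply (smooth_mult (fun _ _ => c)), smooth_const. Qed.

Lemma periodic_plus f g :
  periodic f -> periodic g -> periodic (fun x y => f x y + g x y).
Proof.
intros Hf Hg x y; destruct (Hf x y) as [-> ->], (Hg x y) as [-> ->]; split; reflexivity.
Qed.

Lemma periodic_mult f g :
  periodic f -> periodic g -> periodic (fun x y => f x y * g x y).
Proof.
intros Hf Hg x y; destruct (Hf x y) as [-> ->], (Hg x y) as [-> ->]; split; reflexivity.
Qed.

Lemma periodic_scal c f : periodic f -> periodic (fun x y => c * f x y).
Proof. intros Hf x y; destruct (Hf x y) as [-> ->]; split; reflexivity. Qed.

Lemma Derive_shift (f : R -> R) (x : R) :
  ex_derive f (x + 1) -> Derive (fun t => f (t + 1)) x = Derive f (x + 1).
Proof.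
intros H; apply is_derive_unique; auto_derive; [assumption|].
rewrite Rmult_1_l; reflexivity.
Qed.

Lemma periodic_dx f : smooth f -> periodic f -> periodic (dx f).
Proof.
intros Hs Hp x y; unfold dx; split.
- rewrite <- (Derive_shift (fun t => f t y)) by (apply smooth_ex_dx; auto).
  apply Derive_ext; intros t; apply Hp.
- apply Derive_ext; intros t; apply Hp.
Qed.

Lemma periodic_dy f : smooth f -> periodic f -> periodic (dy f).
Proof.
intros Hs Hp x y; unfold dy; split.
- apply Derive_ext; intros t; apply Hp.
- rewrite <- (Derive_shift (fun t => f x t)) by (apply smooth_ex_dy; auto).
  apply Derive_ext; intros t; apply Hp.
Qed.

(** * Integration *)

Lemma cont2_continuous_y f x y : cont2 f -> continuous (fun t => f x t) y.
Proof.
intros Hf; apply continuity_pt_filterlim.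
intros eps Heps.
destruct (Hf x y (mkposreal eps Heps)) as [d Hd].
exists d; split; [apply cond_pos|].
intros t [_ Ht]; apply Hd; [rewrite Rminus_diag, Rabs_R0; apply cond_pos | exact Ht].
Qed.

Lemma cont2_ex_RInt_y f x : cont2 f -> ex_RInt (fun t => f x t) 0 1.
Proof.
intros Hf; apply (ex_RInt_continuous (V := R_CompleteNormedModule)); intros z _.
apply cont2_continuous_y, Hf.
Qed.

(** Near $x$ the integrands are uniformly close along the compact fibre $[0,1]$, so their integrals
    are close. *)
Lemma cont2_continuous_RInt f x :
  cont2 f -> continuous (fun s => RInt (fun t => f s t) 0 1) x.
Proof.
intros Hf; apply continuity_pt_filterlim.
intros eps Heps.
(* The estimate of the integral is non-strict, so the integrands are compared within [eps / 2]. *)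
assert (He : 0 < eps / 2) by lra.
destruct (uniform_continuity_2d_1d' f 0 1 x (fun t _ => Hf x t)
  (mkposreal _ He)) as [d Hd].
exists d; split; [apply cond_pos|].
intros s [_ Hs]; simpl in Hs |- *; unfold Rdist in Hs |- *.
rewrite <- (RInt_minus (V := R_CompleteNormedModule))
  by apply cont2_ex_RInt_y, Hf.
apply Rle_lt_trans with ((1 - 0) * (eps / 2)); [|lra].
apply abs_RInt_le_const; [lra | | ].
- refine (ex_RInt_minus _ _ _ _ _ _); apply cont2_ex_RInt_y, Hf.
- intros t Ht; apply Rlt_le.
  pose proof (cond_pos d).
  apply (Hd t x t s); try lra.
  + apply Rabs_lt_between in Hs; lra.
  + rewrite Rminus_diag, Rabs_R0; apply cond_pos.
Qed.

Lemma cont2_ex_RInt_x f :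
  cont2 f -> ex_RInt (fun s => RInt (fun t => f s t) 0 1) 0 1.
Proof.
intros Hf; apply (ex_RInt_continuous (V := R_CompleteNormedModule)); intros z _.
apply cont2_continuous_RInt, Hf.
Qed.

Lemma torus_int_plus f g : cont2 f -> cont2 g ->
  torus_int (fun x y => f x y + g x y) = torus_int f + torus_int g.
Proof.
intros Hf Hg; unfold torus_int.
rewrite <- (RInt_plus (V := R_CompleteNormedModule))
  by (apply cont2_ex_RInt_x; assumption).
apply RInt_ext; intros x _.
rewrite <- (RInt_plus (V := R_CompleteNormedModule)); [reflexivity | | ];
  apply cont2_ex_RInt_y; auto.
Qed.

Lemma torus_int_scal c f : cont2 f ->
  torus_int (fun x y => c * f x y) = c * torus_int f.
Proof.
intros Hf; unfold torus_int.
rewrite <- (RInt_scal (V := R_CompleteNormedModule))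
  by apply cont2_ex_RInt_x, Hf.
apply RInt_ext; intros x _.
rewrite <- (RInt_scal (V := R_CompleteNormedModule)); [reflexivity|].
apply cont2_ex_RInt_y, Hf.
Qed.

Lemma torus_int_const c : torus_int (fun _ _ => c) = c.
Proof.
unfold torus_int; rewrite !RInt_const; unfold scal; simpl; unfold mult; simpl; ring.
Qed.

Lemma cont2_abs f : cont2 f -> cont2 (fun x y => Rabs (f x y)).
Proof.
intros Hf x y; apply (continuity_1d_2d_pt_comp Rabs f); [apply Rcontinuity_abs | apply Hf].
Qed.

Lemma torus_int_le f g : cont2 f -> cont2 g ->
  (forall x y, f x y <= g x y) -> torus_int f <= torus_int g.
Proof.
intros Hf Hg H; apply RInt_le; [lra | apply cont2_ex_RInt_x, Hf
  | apply cont2_ex_RInt_x, Hg | intros x _].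
apply RInt_le; [lra | apply cont2_ex_RInt_y, Hf | apply cont2_ex_RInt_y, Hg |].
intros y _; apply H.
Qed.

Lemma torus_int_abs_le f g : cont2 f -> cont2 g ->
  (forall x y, Rabs (f x y) <= g x y) -> Rabs (torus_int f) <= torus_int g.
Proof.
intros Hf Hg H; apply Rabs_le; split.
- replace (- torus_int g) with (torus_int (fun x y => -1 * g x y))
    by (rewrite torus_int_scal by assumption; ring).
  apply torus_int_le; [apply cont2_scal, Hg | apply Hf | intros x y].
  specialize (H x y); apply Rabs_le_between in H; lra.
- apply torus_int_le; [apply Hf | apply Hg | intros x y].
  specialize (H x y); apply Rabs_le_between in H; lra.
Qed.

Lemma torus_int_dy f : smooth f -> periodic f -> torus_int (dy f) = 0.
Proof.
intros Hs Hp; unfold torus_int.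
rewrite (RInt_ext _ (fun _ => 0)).
- rewrite RInt_const; unfold scal; simpl; unfold mult; simpl; ring.
- intros x _; rewrite (RInt_Derive (fun t => f x t)).
  + destruct (Hp x 0) as [_ H]; rewrite Rplus_0_l in H; rewrite H; apply Rminus_diag.
  + intros y _; apply smooth_ex_dy, Hs.
  + intros y _; apply (cont2_continuous_y (dy f)), smooth_cont2, smooth_dy, Hs.
Qed.

(** The inner integral over $y$ is a 1-periodic function of $x$ whose derivative, taken under the
    integral sign, is the inner integral of [dx f]. *)
Lemma torus_int_dx f : smooth f -> periodic f -> torus_int (dx f) = 0.
Proof.
intros Hs Hp; unfold torus_int.
set (F := fun s => RInt (fun t => f s t) 0 1).
assert (HF : forall x, is_derive F x (RInt (fun t => dx f x t) 0 1)).
{ intros x; apply is_derive_RInt_param.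
  - apply filter_forall; intros s t _; apply smooth_ex_dx, Hs.
  - intros t _; apply (smooth_cont2 (dx f)), smooth_dx, Hs.
  - apply filter_forall; intros s; apply cont2_ex_RInt_y, smooth_cont2, Hs. }
assert (HD : Derive F = fun x => RInt (fun t => dx f x t) 0 1).
{ apply functional_extensionality; intros x; apply is_derive_unique, HF. }
change (RInt (fun x => RInt (fun y => dx f x y) 0 1) 0 1 = 0).
rewrite <- HD, RInt_Derive.
- unfold F; rewrite (RInt_ext (fun t => f 1 t) (fun t => f 0 t)); [apply Rminus_diag|].
  intros t _; destruct (Hp 0 t) as [H _]; rewrite Rplus_0_l in H; exact H.
- intros x _; eexists; apply HF.
- intros x _; rewrite HD; apply (cont2_continuous_RInt (dx f)).
  apply smooth_cont2, smooth_dx, Hs.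
Qed.

Lemma torus_int_dx_parts f g :
  smooth f -> periodic f -> smooth g -> periodic g ->
  torus_int (fun x y => dx f x y * g x y) =
  - torus_int (fun x y => f x y * dx g x y).
Proof.
intros Sf Pf Sg Pg.
pose proof (torus_int_dx _ (smooth_mult f g Sf Sg) (periodic_mult f g Pf Pg)) as H.
rewrite dx_mult in H by (apply smooth_ex_dx; auto).
rewrite torus_int_plus in H
  by (apply cont2_mult; apply smooth_cont2; auto using smooth_dx).
lra.
Qed.

Lemma torus_int_dy_parts f g :
  smooth f -> periodic f -> smooth g -> periodic g ->
  torus_int (fun x y => dy f x y * g x y) =
  - torus_int (fun x y => f x y * dy g x y).
Proof.
intros Sf Pf Sg Pg.
pose proof (torus_int_dy _ (smooth_mult f g Sf Sg) (periodic_mult f g Pf Pg)) as H.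
rewrite dy_mult in H by (apply smooth_ex_dy; auto).
rewrite torus_int_plus in H
  by (apply cont2_mult; apply smooth_cont2; auto using smooth_dy).
lra.
Qed.

(** * Trigonometric modes *)

(** The phase [phi] treats cosines and sines together and makes the family closed under
    differentiation up to scalars: each derivative adds $\pi/2$ to it and brings out a frequency. *)
Definition mode (m n : Z) (phi x y : R) : R := cos (phase m n x y + phi).

Lemma cos_plus_PI2 t : cos (t + PI / 2) = - sin t.
Proof. rewrite cos_plus, cos_PI2, sin_PI2; ring. Qed.

Lemma is_derive_mode_x m n phi x y :
  is_derive (fun t => mode m n phi t y) x (freq m * mode m n (phi + PI / 2) x y).
Proof.
unfold mode; rewrite <- Rplus_assoc, cos_plus_PI2; unfold phase.
auto_derive; [trivial | ring].
Qed.

Lemma is_derive_mode_y m n phi x y :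
  is_derive (fun t => mode m n phi x t) y (freq n * mode m n (phi + PI / 2) x y).
Proof.
unfold mode; rewrite <- Rplus_assoc, cos_plus_PI2; unfold phase.
auto_derive; [trivial | ring].
Qed.

Lemma dx_mode m n phi :
  dx (mode m n phi) = (fun x y => freq m * mode m n (phi + PI / 2) x y).
Proof.
apply fun2_ext; intros x y; apply is_derive_unique, is_derive_mode_x.
Qed.

Lemma dy_mode m n phi :
  dy (mode m n phi) = (fun x y => freq n * mode m n (phi + PI / 2) x y).
Proof.
apply fun2_ext; intros x y; apply is_derive_unique, is_derive_mode_y.
Qed.

Lemma cont2_mode m n phi : cont2 (mode m n phi).
Proof.
intros x y; apply (continuity_1d_2d_pt_comp cos).
- apply continuity_cos.
- apply continuity_2d_pt_plus; [|apply continuity_2d_pt_const].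
  apply continuity_2d_pt_plus; apply continuity_2d_pt_mult;
    auto using continuity_2d_pt_const, continuity_2d_pt_id1, continuity_2d_pt_id2.
Qed.

Lemma smooth_mode m n phi : smooth (mode m n phi).
Proof.
apply smooth_class_C; intros k; revert phi; induction k as [|k IH]; intros phi.
- intros x y; split; [apply cont2_mode | exact I].
- apply class_C_S; repeat split.
  + apply cont2_mode.
  + intros x y; eexists; apply is_derive_mode_x.
  + intros x y; eexists; apply is_derive_mode_y.
  + rewrite dx_mode; apply (class_C_mult k (fun _ _ => _)); auto using class_C_const.
  + rewrite dy_mode; apply (class_C_mult k (fun _ _ => _)); auto using class_C_const.
Qed.

Lemma cos_period_Z t (k : Z) : cos (t + 2 * PI * IZR k) = cos t.
Proof.
destruct (Z_le_dec 0 k) as [Hk|Hk].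
- rewrite <- (Z2Nat.id k Hk), <- INR_IZR_INZ.
  replace (t + 2 * PI * INR (Z.to_nat k)) with (t + 2 * INR (Z.to_nat k) * PI) by ring.
  apply cos_period.
- rewrite <- (cos_period _ (Z.to_nat (- k))).
  rewrite INR_IZR_INZ, Z2Nat.id by lia.
  rewrite opp_IZR; f_equal; ring.
Qed.

Lemma periodic_mode m n phi : periodic (mode m n phi).
Proof.
intros x y; unfold mode, phase; split.
- rewrite <- (cos_period_Z (freq m * x + freq n * y + phi) m); f_equal; unfold freq; ring.
- rewrite <- (cos_period_Z (freq m * x + freq n * y + phi) n); f_equal; unfold freq; ring.
Qed.

(** A Kronecker symbol with real values, so that orthogonality relations become identities within
    reach of [ring]. *)
Definition is_zero (m : Z) : R := if Z.eqb m 0 then 1 else 0.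

Lemma freq_neq_0 m : m <> 0%Z -> freq m <> 0.
Proof.
intros Hm; unfold freq; apply Rmult_integral_contrapositive_currified.
- pose proof PI_RGT_0; lra.
- apply not_0_IZR, Hm.
Qed.

Lemma mode_shift m n phi :
  mode m n (phi - PI / 2 + PI / 2) = mode m n phi.
Proof. f_equal; ring. Qed.

(** If [m] or [n] is nonzero, the mode is, up to a nonzero factor, the derivative of the mode with
    phase $\phi-\pi/2$, and a derivative has integral zero. At frequency zero the mode is the
    constant $\cos\phi$. *)
Lemma torus_int_mode m n phi :
  torus_int (mode m n phi) = is_zero m * is_zero n * cos phi.
Proof.
unfold is_zero; destruct (Z.eqb_spec m 0) as [->|Hm].
- destruct (Z.eqb_spec n 0) as [->|Hn].
  + replace (mode 0 0 phi) with (fun _ _ : R => cos phi).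
    * rewrite torus_int_const; ring.
    * apply fun2_ext; intros x y; unfold mode, phase, freq; f_equal; ring.
  + pose proof (torus_int_dy _ (smooth_mode 0 n (phi - PI / 2)) (periodic_mode _ _ _)) as H.
    rewrite dy_mode, torus_int_scal, mode_shift in H by apply cont2_mode.
    apply Rmult_integral in H; destruct H as [H|H]; [|rewrite H; ring].
    exfalso; exact (freq_neq_0 n Hn H).
- pose proof (torus_int_dx _ (smooth_mode m n (phi - PI / 2)) (periodic_mode _ _ _)) as H.
  rewrite dx_mode, torus_int_scal, mode_shift in H by apply cont2_mode.
  apply Rmult_integral in H; destruct H as [H|H]; [|rewrite H; ring].
  exfalso; exact (freq_neq_0 m Hm H).
Qed.

Lemma freq_plus m n : freq (m + n) = freq m + freq n.
Proof. unfold freq; rewrite plus_IZR; ring. Qed.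

Lemma freq_minus m n : freq (m - n) = freq m - freq n.
Proof. unfold freq; rewrite minus_IZR; ring. Qed.

Lemma freq_opp m : freq (- m) = - freq m.
Proof. unfold freq; rewrite opp_IZR; ring. Qed.

Lemma mode_mult m n phi m' n' phi' x y :
  mode m n phi x y * mode m' n' phi' x y =
  / 2 * (mode (m - m') (n - n') (phi - phi') x y
         + mode (m + m') (n + n') (phi + phi') x y).
Proof.
unfold mode, phase; rewrite !freq_plus, !freq_minus.
set (a := freq m * x + freq n * y + phi).
set (b := freq m' * x + freq n' * y + phi').
replace (_ + (phi - phi')) with (a - b) by (unfold a, b; ring).
replace (_ + (phi + phi')) with (a + b) by (unfold a, b; ring).
rewrite cos_minus, cos_plus; field.
Qed.

Lemma torus_int_mode_mult m n phi m' n' phi' :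
  torus_int (fun x y => mode m n phi x y * mode m' n' phi' x y) =
  / 2 * (is_zero (m - m') * is_zero (n - n') * cos (phi - phi')
         + is_zero (m + m') * is_zero (n + n') * cos (phi + phi')).
Proof.
rewrite <- !torus_int_mode, <- torus_int_plus by apply cont2_mode.
rewrite <- torus_int_scal by (apply cont2_plus; apply cont2_mode).
f_equal; apply fun2_ext; intros x y; apply mode_mult.
Qed.

(** * Symmetric sums *)

Lemma sum_Z_ext N a b : (forall m, a m = b m) -> sum_Z N a = sum_Z N b.
Proof. intros H; apply sum_n_ext; intros i; apply H. Qed.

Lemma sum_Z_0 a : sum_Z 0 a = a 0%Z.
Proof. apply sum_O. Qed.

(** Enlarging the symmetric range adds one term at each end. The underlying indices start at 0, so
    the inner block is reindexed by one. *)
Lemma sum_Z_S N a :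
  sum_Z (S N) a = a (- Z.of_nat (S N))%Z + sum_Z N a + a (Z.of_nat (S N)).
Proof.
unfold sum_Z, sum_n.
replace (2 * S N)%nat with (S (S (2 * N))) by lia.
rewrite sum_n_Sm, sum_Sn_m by lia.
rewrite <- sum_n_m_S.
change (@plus R_AbelianMonoid) with Rplus.
apply (f_equal2 Rplus); [apply (f_equal2 Rplus)|].
- apply f_equal; lia.
- apply sum_n_m_ext; intros i; apply f_equal; lia.
- apply f_equal; lia.
Qed.

Lemma sum_Z_plus N a b :
  sum_Z N (fun m => a m + b m) = sum_Z N a + sum_Z N b.
Proof.
induction N as [|N IH]; [rewrite !sum_Z_0; reflexivity|].
rewrite !sum_Z_S, IH; ring.
Qed.

Lemma sum_Z_scal N c a : sum_Z N (fun m => c * a m) = c * sum_Z N a.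
Proof.
induction N as [|N IH]; [rewrite !sum_Z_0; reflexivity|].
rewrite !sum_Z_S, IH; ring.
Qed.

Lemma sum_Z_ge_0 N a : (forall m, 0 <= a m) -> 0 <= sum_Z N a.
Proof.
intros H; induction N as [|N IH]; [rewrite sum_Z_0; apply H|].
rewrite sum_Z_S; pose proof (H (- Z.of_nat (S N))%Z); pose proof (H (Z.of_nat (S N))).
lra.
Qed.

Lemma sum_Z_le N a b : (forall m, a m <= b m) -> sum_Z N a <= sum_Z N b.
Proof.
intros H; induction N as [|N IH]; [rewrite !sum_Z_0; apply H|].
rewrite !sum_Z_S; pose proof (H (- Z.of_nat (S N))%Z); pose proof (H (Z.of_nat (S N))).
lra.
Qed.

Lemma sum_Z_incr N N' a :
  (forall m, 0 <= a m) -> (N <= N')%nat -> sum_Z N a <= sum_Z N' a.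
Proof.
intros H; induction 1 as [|N' HN IH]; [lra|].
rewrite sum_Z_S; pose proof (H (- Z.of_nat (S N'))%Z); pose proof (H (Z.of_nat (S N'))).
lra.
Qed.

Lemma sum_Z_eq_0 N a :
  (forall m, (- Z.of_nat N <= m <= Z.of_nat N)%Z -> a m = 0) -> sum_Z N a = 0.
Proof.
induction N as [|N IH]; intros H; [rewrite sum_Z_0; apply H; lia|].
rewrite sum_Z_S, IH, !H by (intros; try apply H; lia); ring.
Qed.

Lemma sum_Z_single N m a :
  (- Z.of_nat N <= m <= Z.of_nat N)%Z -> (forall k, k <> m -> a k = 0) ->
  sum_Z N a = a m.
Proof.
intros Hm Ha; induction N as [|N IH].
- rewrite sum_Z_0; f_equal; lia.
- rewrite sum_Z_S.
  destruct (Z.eq_dec m (- Z.of_nat (S N))) as [->|H1]; [|destruct (Z.eq_dec m (Z.of_nat (S N))) as [->|H2]].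
  + rewrite sum_Z_eq_0 by (intros; apply Ha; lia).
    rewrite (Ha (Z.of_nat (S N))) by lia; ring.
  + rewrite sum_Z_eq_0 by (intros; apply Ha; lia).
    rewrite (Ha (- Z.of_nat (S N))%Z) by lia; ring.
  + rewrite IH, (Ha (Z.of_nat (S N))), (Ha (- Z.of_nat (S N))%Z) by lia; ring.
Qed.

(** * Sums over squares of frequencies *)

Definition sum_Z2 (N : nat) (a : Z -> Z -> R) : R :=
  sum_Z N (fun m => sum_Z N (fun n => a m n)).

Lemma sum_Z2_ext N a b : (forall m n, a m n = b m n) -> sum_Z2 N a = sum_Z2 N b.
Proof. intros H; apply sum_Z_ext; intros m; apply sum_Z_ext; intros n; apply H. Qed.

Lemma sum_Z2_plus N a b :
  sum_Z2 N (fun m n => a m n + b m n) = sum_Z2 N a + sum_Z2 N b.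
Proof.
unfold sum_Z2; rewrite <- sum_Z_plus.
apply sum_Z_ext; intros m; apply sum_Z_plus.
Qed.

Lemma sum_Z2_scal N c a : sum_Z2 N (fun m n => c * a m n) = c * sum_Z2 N a.
Proof.
unfold sum_Z2; rewrite <- sum_Z_scal.
apply sum_Z_ext; intros m; apply sum_Z_scal.
Qed.

Lemma sum_Z2_mult N a b :
  sum_Z2 N (fun m n => a m * b n) = sum_Z N a * sum_Z N b.
Proof.
unfold sum_Z2; rewrite Rmult_comm, <- sum_Z_scal.
apply sum_Z_ext; intros m; rewrite sum_Z_scal; ring.
Qed.

Lemma sum_Z2_incr N N' a :
  (forall m n, 0 <= a m n) -> (N <= N')%nat -> sum_Z2 N a <= sum_Z2 N' a.
Proof.
intros H HN; apply Rle_trans with (sum_Z N (fun m => sum_Z N' (a m))).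
- apply sum_Z_le; intros m; apply sum_Z_incr; auto.
- apply sum_Z_incr; auto; intros m; apply sum_Z_ge_0; auto.
Qed.

(** Both $b+a$ and $b-a$ are nonnegative, so their sums grow with the square; this bounds the
    increment of the sum of $a$ from both sides. *)
Lemma sum_Z2_tail N N' a b :
  (forall m n, Rabs (a m n) <= b m n) -> (N <= N')%nat ->
  Rabs (sum_Z2 N' a - sum_Z2 N a) <= sum_Z2 N' b - sum_Z2 N b.
Proof.
intros H HN; apply Rabs_le; split.
- assert (Hi : sum_Z2 N (fun m n => b m n + a m n) <= sum_Z2 N' (fun m n => b m n + a m n)).
  { apply sum_Z2_incr; [|exact HN]; intros m n; specialize (H m n).
    apply Rabs_le_between in H; lra. }
  rewrite !sum_Z2_plus in Hi; lra.
- assert (Hi : sum_Z2 N (fun m n => b m n + -1 * a m n) <= sum_Z2 N' (fun m n => b m n + -1 * a m n)).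
  { apply sum_Z2_incr; [|exact HN]; intros m n; specialize (H m n).
    apply Rabs_le_between in H; lra. }
  rewrite !sum_Z2_plus, !sum_Z2_scal in Hi; lra.
Qed.

Lemma sum_Z2_single N m n a :
  (- Z.of_nat N <= m <= Z.of_nat N)%Z -> (- Z.of_nat N <= n <= Z.of_nat N)%Z ->
  sum_Z2 N (fun k l => is_zero (m - k) * is_zero (n - l) * a k l) = a m n.
Proof.
intros Hm Hn; unfold sum_Z2, is_zero.
rewrite (sum_Z_single N m); [| exact Hm |].
- rewrite (sum_Z_single N n); [| exact Hn |].
  + rewrite !Z.sub_diag; simpl; ring.
  + intros l Hl; destruct (Z.eqb_spec (n - l) 0); [lia | ring].
- intros k Hk; apply sum_Z_eq_0; intros l _.
  destruct (Z.eqb_spec (m - k) 0); [lia | ring].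
Qed.

Lemma cont2_sum_Z N (F : Z -> R -> R -> R) :
  (forall m, cont2 (F m)) -> cont2 (fun x y => sum_Z N (fun m => F m x y)).
Proof.
intros H; induction N as [|N IH].
- replace (fun x y => _) with (F 0%Z); [apply H|].
  apply fun2_ext; intros x y; rewrite sum_Z_0; reflexivity.
- replace (fun x y => _) with (fun x y => (F (- Z.of_nat (S N))%Z x y
    + sum_Z N (fun m => F m x y)) + F (Z.of_nat (S N)) x y).
  + apply cont2_plus; [apply cont2_plus|]; auto.
  + apply fun2_ext; intros x y; rewrite sum_Z_S; reflexivity.
Qed.

Lemma torus_int_sum_Z N (F : Z -> R -> R -> R) :
  (forall m, cont2 (F m)) ->
  torus_int (fun x y => sum_Z N (fun m => F m x y)) =
  sum_Z N (fun m => torus_int (F m)).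
Proof.
intros H; induction N as [|N IH].
- rewrite sum_Z_0; f_equal; apply fun2_ext; intros x y; apply sum_Z_0.
- rewrite sum_Z_S, <- IH, <- !torus_int_plus;
    auto using cont2_plus, cont2_sum_Z.
  f_equal; apply fun2_ext; intros x y; apply sum_Z_S.
Qed.

Lemma cont2_sum_Z2 N (F : Z -> Z -> R -> R -> R) :
  (forall m n, cont2 (F m n)) -> cont2 (fun x y => sum_Z2 N (fun m n => F m n x y)).
Proof.
intros H; apply (cont2_sum_Z N (fun m x y => sum_Z N (fun n => F m n x y))).
intros m; apply cont2_sum_Z, H.
Qed.

Lemma torus_int_sum_Z2 N (F : Z -> Z -> R -> R -> R) :
  (forall m n, cont2 (F m n)) ->
  torus_int (fun x y => sum_Z2 N (fun m n => F m n x y)) =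
  sum_Z2 N (fun m n => torus_int (F m n)).
Proof.
intros H; unfold sum_Z2.
rewrite (torus_int_sum_Z N (fun m x y => sum_Z N (fun n => F m n x y)))
  by (intros m; apply cont2_sum_Z, H).
apply sum_Z_ext; intros m; apply torus_int_sum_Z, H.
Qed.

(** * Fourier partial sums of the half-Laplacian *)

(** Real counterpart of [fourier_coef]: one real family indexed by the phase replaces real and
    imaginary parts. *)
Definition mode_coef (f : R -> R -> R) (m n : Z) (phi : R) : R :=
  torus_int (fun x y => f x y * mode m n phi x y).

(* The partial sums in [half_laplacian], in real form: the phases [0] and
   [- PI / 2] give the cosine and the sine. *)
Definition psum (f : R -> R -> R) (N : nat) (x y : R) : R :=
  sum_Z2 N (fun m n => symbol m n *
    (mode_coef f m n 0 * mode m n 0 x y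
     + mode_coef f m n (- (PI / 2)) * mode m n (- (PI / 2)) x y)).

Lemma mode_cos m n x y : mode m n 0 x y = cos (phase m n x y).
Proof. unfold mode; f_equal; ring. Qed.

Lemma mode_sin m n x y : mode m n (- (PI / 2)) x y = sin (phase m n x y).
Proof.
unfold mode; rewrite <- (cos_shift (phase m n x y)), <- cos_neg; f_equal; ring.
Qed.

Lemma cont2_mult_mode f m n phi :
  cont2 f -> cont2 (fun x y => f x y * mode m n phi x y).
Proof. intros Hf; apply cont2_mult; [exact Hf | apply cont2_mode]. Qed.

Lemma fourier_coef_mode f m n : cont2 f ->
  fourier_coef f m n = (mode_coef f m n 0, - mode_coef f m n (- (PI / 2))).
Proof.
intros Hf; unfold fourier_coef, torus_int_C; f_equal.
- unfold mode_coef; f_equal; apply fun2_ext; intros x y.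
  rewrite mode_cos; simpl; rewrite cos_neg; ring.
- replace (- mode_coef f m n (- (PI / 2))) with (-1 * mode_coef f m n (- (PI / 2))) by ring.
  unfold mode_coef; rewrite <- torus_int_scal by apply cont2_mult_mode, Hf.
  f_equal; apply fun2_ext; intros x y.
  rewrite mode_sin; simpl; rewrite sin_neg; ring.
Qed.

Lemma half_laplacian_psum f x y : cont2 f ->
  half_laplacian f x y = real (Lim_seq (fun N => psum f N x y)).
Proof.
intros Hf; unfold half_laplacian; f_equal; apply Lim_seq_ext; intros N.
apply sum_Z2_ext; intros m n.
rewrite fourier_coef_mode by exact Hf; rewrite mode_cos, mode_sin; simpl; ring.
Qed.

Lemma psum_cont2 f N : cont2 (psum f N).
Proof.
apply cont2_sum_Z2; intros m n.
apply cont2_scal, cont2_plus; apply cont2_scal, cont2_mode.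
Qed.

(** The pairing becomes a bilinear expression in the coefficients, symmetric in [f] and [g]; this is
    the self-adjointness of the truncated operator. *)
Lemma torus_int_psum f g N : cont2 f ->
  torus_int (fun x y => f x y * psum g N x y) =
  sum_Z2 N (fun m n => symbol m n *
    (mode_coef g m n 0 * mode_coef f m n 0
     + mode_coef g m n (- (PI / 2)) * mode_coef f m n (- (PI / 2)))).
Proof.
intros Hf.
set (F := fun (m n : Z) (x y : R) => symbol m n *
    (mode_coef g m n 0 * (f x y * mode m n 0 x y)
     + mode_coef g m n (- (PI / 2)) * (f x y * mode m n (- (PI / 2)) x y))).
replace (fun x y => f x y * psum g N x y)
  with (fun x y => sum_Z2 N (fun m n => F m n x y)).
- rewrite torus_int_sum_Z2.
  + apply sum_Z2_ext; intros m n; unfold F.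
    rewrite torus_int_scal, torus_int_plus, !torus_int_scal;
      auto using cont2_plus, cont2_scal, cont2_mult_mode.
  + intros m n; unfold F; auto using cont2_plus, cont2_scal, cont2_mult_mode.
- apply fun2_ext; intros x y; unfold psum; rewrite <- sum_Z2_scal.
  apply sum_Z2_ext; intros m n; unfold F; ring.
Qed.

Lemma torus_int_psum_sym f g N : cont2 f -> cont2 g ->
  torus_int (fun x y => f x y * psum g N x y) =
  torus_int (fun x y => psum f N x y * g x y).
Proof.
intros Hf Hg; rewrite torus_int_psum by exact Hf.
replace (fun x y => psum f N x y * g x y) with (fun x y => g x y * psum f N x y)
  by (apply fun2_ext; intros; ring).
rewrite torus_int_psum by exact Hg.
apply sum_Z2_ext; intros m n; ring.
Qed.

(** * Trigonometric polynomials *)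

Lemma mode_coef_plus f g m n phi : cont2 f -> cont2 g ->
  mode_coef (fun x y => f x y + g x y) m n phi =
  mode_coef f m n phi + mode_coef g m n phi.
Proof.
intros Hf Hg; unfold mode_coef.
rewrite <- torus_int_plus by (apply cont2_mult_mode; assumption).
f_equal; apply fun2_ext; intros; ring.
Qed.

Lemma mode_coef_scal c f m n phi : cont2 f ->
  mode_coef (fun x y => c * f x y) m n phi = c * mode_coef f m n phi.
Proof.
intros Hf; unfold mode_coef.
rewrite <- torus_int_scal by (apply cont2_mult_mode; assumption).
f_equal; apply fun2_ext; intros; ring.
Qed.

Lemma mode_coef_mode m n phi m' n' phi' :
  mode_coef (mode m n phi) m' n' phi' =
  / 2 * (is_zero (m - m') * is_zero (n - n') * cos (phi - phi')
         + is_zero (m + m') * is_zero (n + n') * cos (phi + phi')).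
Proof. apply torus_int_mode_mult. Qed.

Lemma symbol_opp m n : symbol (- m) (- n) = symbol m n.
Proof. unfold symbol; rewrite !freq_opp; f_equal; ring. Qed.

(** The partial sums are eventually equal to [g], so the limit is attained. This holds for
    trigonometric polynomials and passes to linear combinations. *)
Definition has_half_laplacian (f g : R -> R -> R) : Prop :=
  cont2 f /\ exists N0, forall N, (N0 <= N)%nat -> forall x y, psum f N x y = g x y.

Lemma has_half_laplacian_mode m n phi :
  has_half_laplacian (mode m n phi) (fun x y => symbol m n * mode m n phi x y).
Proof.
split; [apply cont2_mode|].
(* Squares of this size contain both [(m, n)] and [(- m, - n)]. *)
exists (Z.to_nat (Z.abs m + Z.abs n)); intros N HN x y.
set (a := fun k l : Z => symbol k l * mode k l phi x y).
set (b := fun k l : Z => symbol k l * mode k l (- phi) x y).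
(* The real mode has its coefficients at the two opposite frequencies; each of them restores half of
   the mode, and [symbol] is even. *)
transitivity (/ 2 * (sum_Z2 N (fun k l => is_zero (m - k) * is_zero (n - l) * a k l)
  + sum_Z2 N (fun k l => is_zero (- m - k) * is_zero (- n - l) * b k l))).
- rewrite <- sum_Z2_plus, <- sum_Z2_scal; apply sum_Z2_ext; intros k l.
  rewrite !mode_coef_mode; unfold a, b.
  assert (Hz : forall i j, is_zero (- i - j) = is_zero (i + j)).
  { intros i j; unfold is_zero; destruct (Z.eqb_spec (- i - j) 0), (Z.eqb_spec (i + j) 0);
      reflexivity || lia. }
  rewrite !Hz, mode_cos, mode_sin; unfold mode.
  rewrite Rminus_0_r, Rplus_0_r.
  replace (phi - - (PI / 2)) with (phi + PI / 2) by ring.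
  rewrite cos_plus_PI2, !cos_plus, !cos_neg, !sin_neg, cos_PI2, sin_PI2; ring.
- rewrite !sum_Z2_single by lia; unfold a, b.
  rewrite symbol_opp.
  replace (mode (- m) (- n) (- phi) x y) with (mode m n phi x y); [field|].
  unfold mode; rewrite <- cos_neg; f_equal; unfold phase; rewrite !freq_opp; ring.
Qed.

Lemma has_half_laplacian_plus f g f' g' :
  has_half_laplacian f g -> has_half_laplacian f' g' ->
  has_half_laplacian (fun x y => f x y + f' x y) (fun x y => g x y + g' x y).
Proof.
intros [Cf [N1 H1]] [Cf' [N2 H2]]; split; [apply cont2_plus; assumption|].
exists (max N1 N2); intros N HN x y.
rewrite <- (H1 N), <- (H2 N) by lia; unfold psum; rewrite <- sum_Z2_plus.
apply sum_Z2_ext; intros m n; rewrite !mode_coef_plus by assumption; ring.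
Qed.

Lemma has_half_laplacian_scal c f g :
  has_half_laplacian f g ->
  has_half_laplacian (fun x y => c * f x y) (fun x y => c * g x y).
Proof.
intros [Cf [N1 H1]]; split; [apply cont2_scal; assumption|].
exists N1; intros N HN x y.
rewrite <- (H1 N) by lia; unfold psum; rewrite <- sum_Z2_scal.
apply sum_Z2_ext; intros m n; rewrite !mode_coef_scal by assumption; ring.
Qed.

Lemma half_laplacian_eq f g : has_half_laplacian f g -> half_laplacian f = g.
Proof.
intros [Cf [N0 H]]; apply fun2_ext; intros x y.
rewrite half_laplacian_psum by exact Cf.
rewrite (Lim_seq_ext_loc _ (fun _ => g x y)).
- rewrite Lim_seq_const; reflexivity.
- exists N0; intros N HN; apply H, HN.
Qed.

(** * Decay of Fourier coefficients and self-adjointness *)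

(** Two integrations by parts move both derivatives onto the mode, whose phase then grows by $\pi$,
    which gives the sign. *)
Lemma mode_coef_dx2 f m n phi : smooth f -> periodic f ->
  mode_coef (dx (dx f)) m n phi = - freq m ^ 2 * mode_coef f m n phi.
Proof.
intros Sf Pf; unfold mode_coef.
rewrite torus_int_dx_parts, dx_mode;
  auto using smooth_dx, periodic_dx, smooth_mode, periodic_mode.
replace (fun x y => dx f x y * (freq m * mode m n (phi + PI / 2) x y))
  with (fun x y => freq m * (dx f x y * mode m n (phi + PI / 2) x y))
  by (apply fun2_ext; intros; ring).
rewrite torus_int_scal by (apply cont2_mult_mode, smooth_cont2, smooth_dx, Sf).
rewrite torus_int_dx_parts, dx_mode by auto using smooth_mode, periodic_mode.
replace (fun x y => f x y * (freq m * mode m n (phi + PI / 2 + PI / 2) x y))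
  with (fun x y => - freq m * (f x y * mode m n phi x y)).
- rewrite torus_int_scal by (apply cont2_mult_mode, smooth_cont2, Sf); ring.
- apply fun2_ext; intros x y; unfold mode.
  rewrite <- !Rplus_assoc, cos_plus_PI2.
  replace (_ + PI / 2) with (PI / 2 + (phase m n x y + phi)) by ring.
  rewrite <- cos_sin; ring.
Qed.

Lemma mode_coef_dy2 f m n phi : smooth f -> periodic f ->
  mode_coef (dy (dy f)) m n phi = - freq n ^ 2 * mode_coef f m n phi.
Proof.
intros Sf Pf; unfold mode_coef.
rewrite torus_int_dy_parts, dy_mode;
  auto using smooth_dy, periodic_dy, smooth_mode, periodic_mode.
replace (fun x y => dy f x y * (freq n * mode m n (phi + PI / 2) x y))
  with (fun x y => freq n * (dy f x y * mode m n (phi + PI / 2) x y))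
  by (apply fun2_ext; intros; ring).
rewrite torus_int_scal by (apply cont2_mult_mode, smooth_cont2, smooth_dy, Sf).
rewrite torus_int_dy_parts, dy_mode by auto using smooth_mode, periodic_mode.
replace (fun x y => f x y * (freq n * mode m n (phi + PI / 2 + PI / 2) x y))
  with (fun x y => - freq n * (f x y * mode m n phi x y)).
- rewrite torus_int_scal by (apply cont2_mult_mode, smooth_cont2, Sf); ring.
- apply fun2_ext; intros x y; unfold mode.
  rewrite <- !Rplus_assoc, cos_plus_PI2.
  replace (_ + PI / 2) with (PI / 2 + (phase m n x y + phi)) by ring.
  rewrite <- cos_sin; ring.
Qed.

(** The operator $1-\partial_x^2$. Its multiplier [1 + freq m ^ 2] is invertible also at [m = 0], so
    the decay estimate has no exceptional frequency. *)
Definition sub_dx2 (f : R -> R -> R) : R -> R -> R :=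
  fun x y => f x y + -1 * dx (dx f) x y.

Definition sub_dy2 (f : R -> R -> R) : R -> R -> R :=
  fun x y => f x y + -1 * dy (dy f) x y.

Lemma sub_dx2_spec f : smooth f -> periodic f ->
  smooth (sub_dx2 f) /\ periodic (sub_dx2 f) /\
  forall m n phi, mode_coef (sub_dx2 f) m n phi = (1 + freq m ^ 2) * mode_coef f m n phi.
Proof.
intros Sf Pf; repeat split.
- apply smooth_plus; [exact Sf | apply smooth_scal; auto using smooth_dx].
- apply (periodic_plus f (fun x y => -1 * dx (dx f) x y) Pf);
    apply periodic_scal; auto using smooth_dx, periodic_dx.
- apply (periodic_plus f (fun x y => -1 * dx (dx f) x y) Pf);
    apply periodic_scal; auto using smooth_dx, periodic_dx.
- intros m n phi; unfold sub_dx2.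
  rewrite mode_coef_plus, mode_coef_scal, mode_coef_dx2; auto using smooth_cont2, smooth_dx, cont2_scal.
  ring.
Qed.

Lemma sub_dy2_spec f : smooth f -> periodic f ->
  smooth (sub_dy2 f) /\ periodic (sub_dy2 f) /\
  forall m n phi, mode_coef (sub_dy2 f) m n phi = (1 + freq n ^ 2) * mode_coef f m n phi.
Proof.
intros Sf Pf; repeat split.
- apply smooth_plus; [exact Sf | apply smooth_scal; auto using smooth_dy].
- apply (periodic_plus f (fun x y => -1 * dy (dy f) x y) Pf);
    apply periodic_scal; auto using smooth_dy, periodic_dy.
- apply (periodic_plus f (fun x y => -1 * dy (dy f) x y) Pf);
    apply periodic_scal; auto using smooth_dy, periodic_dy.
- intros m n phi; unfold sub_dy2.
  rewrite mode_coef_plus, mode_coef_scal, mode_coef_dy2; auto using smooth_cont2, smooth_dy, cont2_scal.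
  ring.
Qed.

(** The reciprocal of the multiplier of $1-\partial^2$ in one variable; it is summable over the
    integers. *)
Definition decay (m : Z) : R := / (1 + freq m ^ 2).

(** The coefficients of $(1-\partial_y^2)^2(1-\partial_x^2)^2f$ are bounded by its $L^1$ norm, since
    modes are bounded by 1. The power 2 leaves one factor to absorb the symbol and one to sum. *)
Lemma mode_coef_decay f : smooth f -> periodic f ->
  exists K, 0 <= K /\ forall m n phi,
    Rabs (mode_coef f m n phi) <= K * (decay m * decay n) ^ 2.
Proof.
intros Sf Pf.
destruct (sub_dx2_spec f Sf Pf) as (S1 & P1 & E1).
destruct (sub_dx2_spec _ S1 P1) as (S2 & P2 & E2).
destruct (sub_dy2_spec _ S2 P2) as (S3 & P3 & E3).
destruct (sub_dy2_spec _ S3 P3) as (S4 & P4 & E4).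
set (g := sub_dy2 _) in S4, E4.
assert (Cg : cont2 g) by apply smooth_cont2, S4.
exists (torus_int (fun x y => Rabs (g x y))); split.
- rewrite <- (torus_int_const 0); apply torus_int_le; auto using cont2_const, cont2_abs.
  intros; apply Rabs_pos.
- intros m n phi.
  assert (H : Rabs (mode_coef g m n phi) <= torus_int (fun x y => Rabs (g x y))).
  { apply torus_int_abs_le; auto using cont2_mult_mode, cont2_abs.
    intros x y; rewrite Rabs_mult; rewrite <- (Rmult_1_r (Rabs (g x y))) at 2.
    apply Rmult_le_compat_l; [apply Rabs_pos|].
    apply Rabs_le; unfold mode; apply COS_bound. }
  rewrite E4, E3, E2, E1 in H; unfold decay.
  assert (Hm : 0 < 1 + freq m ^ 2) by nra.
  assert (Hn : 0 < 1 + freq n ^ 2) by nra.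
  replace (mode_coef f m n phi) with
    ((1 + freq n ^ 2) * ((1 + freq n ^ 2) * ((1 + freq m ^ 2) * ((1 + freq m ^ 2) * mode_coef f m n phi)))
     * (/ (1 + freq m ^ 2) * / (1 + freq n ^ 2)) ^ 2) by (field; lra).
  rewrite Rabs_mult, (Rabs_pos_eq ((_ * _) ^ 2)) by apply pow2_ge_0.
  apply Rmult_le_compat_r; [apply pow2_ge_0 | exact H].
Qed.

Lemma decay_pos m : 0 < decay m.
Proof. apply Rinv_0_lt_compat; nra. Qed.

(** With $P=(1+a^2)(1+b^2)\ge 1$ one has $a^2+b^2\le P\le P^2$; then take square roots. *)
Lemma symbol_decay m n : symbol m n * (decay m * decay n) <= 1.
Proof.
unfold decay; rewrite <- Rinv_mult.
set (a := freq m); set (b := freq n).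
assert (Ha : 0 < (1 + a ^ 2) * (1 + b ^ 2)) by nra.
apply (Rmult_le_reg_r _ _ _ Ha).
rewrite Rmult_assoc, Rinv_l, Rmult_1_r, Rmult_1_l by lra.
unfold symbol; fold a b.
rewrite <- (sqrt_Rsqr ((1 + a ^ 2) * (1 + b ^ 2))) by lra.
apply sqrt_le_1_alt; unfold Rsqr.
assert (0 <= a ^ 2) by nra; assert (0 <= b ^ 2) by nra.
assert (1 + a ^ 2 + b ^ 2 <= (1 + a ^ 2) * (1 + b ^ 2)) by nra.
nra.
Qed.

Lemma decay_sum_bounded N : sum_Z N decay <= 3.
Proof.
(* A telescoping bound: equality at [N = 0], and each of the two new terms is at most
   $1/(N+1)-1/(N+2)$. *)
assert (H : forall N, sum_Z N decay <= 3 - 2 / INR (S N)).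
{ clear N; induction N as [|N IH].
  - rewrite sum_Z_0; unfold decay, freq; simpl; rewrite Rmult_0_r, Rmult_0_l, Rplus_0_r.
    rewrite Rinv_1; lra.
  - rewrite sum_Z_S.
    replace (decay (- Z.of_nat (S N))) with (decay (Z.of_nat (S N)))
      by (unfold decay; rewrite freq_opp; f_equal; ring).
    assert (Hk : decay (Z.of_nat (S N)) <= / INR (S N) - / INR (S (S N))).
    { pose proof (pos_INR N).
      replace (/ INR (S N) - / INR (S (S N))) with (/ (INR (S N) * INR (S (S N))))
        by (rewrite (S_INR (S N)), (S_INR N); field; lra).
      apply Rinv_le_contravar.
      - rewrite (S_INR (S N)), (S_INR N); nra.
      - unfold freq; rewrite <- INR_IZR_INZ, (S_INR (S N)), (S_INR N).
        (* Since $\pi>2$, the square of the frequency of $k=N+1$ is at least $4k^2\ge k(k+1)$. *)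
        pose proof PI2_1.
        assert (4 <= (2 * PI) ^ 2) by nra.
        nra. }
    unfold Rdiv in *; lra. }
specialize (H N); pose proof (pos_INR N).
assert (0 < 2 / INR (S N)); [|lra].
rewrite S_INR; apply Rdiv_lt_0_compat; lra.
Qed.

(** Weierstrass majorant test: the terms are dominated, uniformly in [x] and [y], by a summable
    family, and the error is the tail of the majorant. *)
Lemma psum_uniform_cvg g : smooth g -> periodic g ->
  exists e : nat -> R, is_lim_seq e 0 /\
    forall N x y, Rabs (psum g N x y - half_laplacian g x y) <= e N.
Proof.
intros Sg Pg.
destruct (mode_coef_decay g Sg Pg) as (K & HK & HD).
assert (Hterm : forall x y m n, Rabs (symbol m n *
    (mode_coef g m n 0 * mode m n 0 x y
     + mode_coef g m n (- (PI / 2)) * mode m n (- (PI / 2)) x y))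
  <= 2 * K * (decay m * decay n)).
{ intros x y m n.
  assert (Hb : forall phi, Rabs (mode_coef g m n phi * mode m n phi x y)
    <= K * (decay m * decay n) ^ 2).
  { intros phi; rewrite Rabs_mult, <- (Rmult_1_r (K * _)).
    apply Rmult_le_compat; auto using Rabs_pos.
    apply Rabs_le; unfold mode; apply COS_bound. }
  pose proof (Hb 0) as H1; pose proof (Hb (- (PI / 2))) as H2.
  pose proof (decay_pos m); pose proof (decay_pos n).
  assert (Hs : 0 <= symbol m n) by apply sqrt_pos.
  rewrite Rabs_mult, (Rabs_pos_eq _ Hs).
  apply Rle_trans with (symbol m n * (2 * K * (decay m * decay n) ^ 2)).
  - apply Rmult_le_compat_l; [exact Hs|].
    eapply Rle_trans; [apply Rabs_triang | lra].
  (* One of the two decay factors cancels the symbol; the other stays as majorant. *)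
  - replace (symbol m n * (2 * K * (decay m * decay n) ^ 2)) with
      (symbol m n * (decay m * decay n) * (2 * K * (decay m * decay n))) by ring.
    rewrite <- (Rmult_1_l (2 * K * (decay m * decay n))) at 2.
    apply Rmult_le_compat_r; [|apply symbol_decay].
    apply Rmult_le_pos; [lra|]; apply Rmult_le_pos; lra. }
set (T := fun N => sum_Z2 N (fun m n => 2 * K * (decay m * decay n))).
assert (Hcauchy : forall N N' x y, (N <= N')%nat ->
  Rabs (psum g N' x y - psum g N x y) <= T N' - T N).
{ intros N N' x y HN; apply sum_Z2_tail; auto. }
assert (HT : ex_finite_lim_seq T).
{ apply (ex_finite_lim_seq_incr T (2 * K * (3 * 3))).
  - intros N; apply sum_Z2_incr; [|lia]; intros m n.
    pose proof (decay_pos m); pose proof (decay_pos n).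
    apply Rmult_le_pos; [lra|]; apply Rmult_le_pos; lra.
  (* The majorant is a product in [m] and [n], so its sum is a product of two sums, each at most
     3. *)
  - intros N; unfold T; rewrite sum_Z2_scal, sum_Z2_mult.
    apply Rmult_le_compat_l; [lra|].
    pose proof (decay_sum_bounded N).
    assert (0 <= sum_Z N decay) by (apply sum_Z_ge_0; intros; apply Rlt_le, decay_pos).
    apply Rmult_le_compat; assumption. }
destruct HT as [L HL].
(* The partial sums are Cauchy, so [Lim_seq] in [half_laplacian] is finite and [real] returns the
   true limit. *)
assert (Hlim : forall x y, is_lim_seq (fun N => psum g N x y) (half_laplacian g x y)).
{ intros x y; rewrite half_laplacian_psum by apply smooth_cont2, Sg.
  apply Lim_seq_correct', ex_lim_seq_cauchy_corr.
  assert (HC : ex_finite_lim_seq T) by (exists L; exact HL).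
  apply ex_lim_seq_cauchy_corr in HC.
  intros eps; destruct (HC eps) as [N0 HN0]; exists N0; intros n m Hn Hm.
  destruct (le_ge_dec m n) as [Hmn|Hmn].
  - eapply Rle_lt_trans; [apply Hcauchy, Hmn|].
    eapply Rle_lt_trans; [apply Rle_abs | apply HN0; assumption].
  - rewrite Rabs_minus_sym.
    eapply Rle_lt_trans; [apply Hcauchy; lia|].
    eapply Rle_lt_trans; [apply Rle_abs | apply HN0; assumption]. }
exists (fun N => L - T N); split.
- replace (Finite 0) with (Finite (L - L)) by (f_equal; ring).
  apply is_lim_seq_minus'; [apply is_lim_seq_const | exact HL].
(* Let the larger index tend to infinity in [Hcauchy]. *)
- intros N x y; rewrite Rabs_minus_sym.
  assert (H1 : is_lim_seq (fun N' => Rabs (psum g N' x y - psum g N x y))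
    (Rabs (half_laplacian g x y - psum g N x y))).
  { apply (is_lim_seq_abs _ (Finite _)), is_lim_seq_minus';
      [apply Hlim | apply is_lim_seq_const]. }
  assert (H2 : is_lim_seq (fun N' => T N' - T N) (L - T N)).
  { apply is_lim_seq_minus'; [exact HL | apply is_lim_seq_const]. }
  refine (is_lim_seq_le_loc _ _ (Finite _) (Finite _) _ H1 H2).
  exists N; intros N' HN; apply Hcauchy, HN.
Qed.

Lemma cont2_uniform_limit (F : nat -> R -> R -> R) G (e : nat -> R) :
  (forall N, cont2 (F N)) -> is_lim_seq e 0 ->
  (forall N x y, Rabs (F N x y - G x y) <= e N) -> cont2 G.
Proof.
intros CF He H x y eps.
assert (He3 : 0 < eps / 3) by (pose proof (cond_pos eps); lra).
apply is_lim_seq_spec in He; destruct (He (mkposreal _ He3)) as [N HN].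
specialize (HN N (le_n N)); simpl in HN; rewrite Rminus_0_r in HN.
apply Rabs_lt_between in HN.
destruct (CF N x y (mkposreal _ He3)) as [d Hd].
exists d; intros u v Hu Hv; specialize (Hd u v Hu Hv); simpl in Hd.
pose proof (H N u v) as H1; pose proof (H N x y) as H2.
apply Rabs_lt_between in Hd; apply Rabs_le_between in H1; apply Rabs_le_between in H2.
apply Rabs_lt_between; lra.
Qed.

(** The integrals of [f] times [psum g N] tend to the left side, by uniform convergence and the
    bound on [f]. By symmetry of the partial sums they equal the right side for large [N]. *)
Lemma half_laplacian_selfadjoint f Lf M g :
  has_half_laplacian f Lf -> (forall x y, Rabs (f x y) <= M) ->
  smooth g -> periodic g ->
  torus_int (fun x y => f x y * half_laplacian g x y) =
  torus_int (fun x y => Lf x y * g x y).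
Proof.
intros [Cf [N0 HN0]] HM Sg Pg.
destruct (psum_uniform_cvg g Sg Pg) as (e & He & H).
assert (Cg : cont2 g) by apply smooth_cont2, Sg.
assert (CL : cont2 (half_laplacian g))
  by (apply (cont2_uniform_limit (psum g) _ e); auto using psum_cont2).
assert (HM0 : 0 <= M) by (eapply Rle_trans; [apply Rabs_pos | apply (HM 0 0)]).
assert (Hl : is_lim_seq (fun N => torus_int (fun x y => f x y * psum g N x y))
  (torus_int (fun x y => f x y * half_laplacian g x y))).
{ apply is_lim_seq_spec; intros eps.
  assert (HeM : is_lim_seq (fun N => M * e N) 0).
  { replace (Finite 0) with (Rbar_mult M 0) by (simpl; f_equal; ring).
    apply is_lim_seq_scal_l, He. }
  apply is_lim_seq_spec in HeM; destruct (HeM eps) as [N1 HN1]; exists N1; intros N HN.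
  specialize (HN1 N HN); rewrite Rminus_0_r in HN1.
  eapply Rle_lt_trans; [|eapply Rle_lt_trans; [apply Rle_abs | apply HN1]].
  replace (torus_int (fun x y => f x y * psum g N x y) -
    torus_int (fun x y => f x y * half_laplacian g x y))
    with (torus_int (fun x y => f x y * psum g N x y + -1 * (f x y * half_laplacian g x y))).
  - rewrite <- (torus_int_const (M * e N)).
    apply torus_int_abs_le; auto using cont2_plus, cont2_mult, cont2_scal, cont2_const, psum_cont2.
    intros x y.
    replace (f x y * psum g N x y + -1 * (f x y * half_laplacian g x y))
      with (f x y * (psum g N x y - half_laplacian g x y)) by ring.
    rewrite Rabs_mult; apply Rmult_le_compat; auto using Rabs_pos.
  - rewrite torus_int_plus, torus_int_scal;
      auto using cont2_plus, cont2_mult, cont2_scal, psum_cont2; ring. }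
apply is_lim_seq_unique in Hl.
rewrite (Lim_seq_ext_loc _ (fun _ => torus_int (fun x y => Lf x y * g x y))),
  Lim_seq_const in Hl.
- injection Hl; auto.
- exists N0; intros N HN; rewrite torus_int_psum_sym by assumption.
  f_equal; apply fun2_ext; intros x y; rewrite HN0 by exact HN; reflexivity.
Qed.

(** * The coadjoint operator *)

(** The sign is written as a scaling by -1 so that the rules for sums and multiples apply. *)
Lemma poisson_eq g f :
  poisson g f = (fun x y => -1 * (dx g x y * dy f x y) + dy g x y * dx f x y).
Proof. apply fun2_ext; intros x y; unfold poisson, dot; simpl; ring. Qed.

Lemma poisson_antisym f g : poisson g f = (fun x y => -1 * poisson f g x y).
Proof. rewrite !poisson_eq; apply fun2_ext; intros; ring. Qed.

Lemma poisson_scal_r c f g :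
  poisson g (fun x y => c * f x y) = (fun x y => c * poisson g f x y).
Proof. rewrite !poisson_eq, dx_scal, dy_scal; apply fun2_ext; intros; ring. Qed.

Lemma smooth_poisson f g : smooth f -> smooth g -> smooth (poisson g f).
Proof.
intros Sf Sg; rewrite poisson_eq; apply smooth_plus; [apply smooth_scal|];
  apply smooth_mult; auto using smooth_dx, smooth_dy.
Qed.

Lemma periodic_poisson f g :
  smooth f -> smooth g -> periodic f -> periodic g -> periodic (poisson g f).
Proof.
intros Sf Sg Pf Pg; rewrite poisson_eq; apply periodic_plus; [apply periodic_scal|];
  apply periodic_mult; auto using periodic_dx, periodic_dy.
Qed.

Lemma smooth_schwarz f : smooth f -> dx (dy f) = dy (dx f).
Proof.
intros Sf; apply fun2_ext; intros x y; apply (Schwarz f).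
- exists (mkposreal 1 Rlt_0_1); intros u v _ _; repeat split.
  + apply smooth_ex_dx, Sf.
  + apply smooth_ex_dy, Sf.
  + apply (smooth_ex_dx (dy f)), smooth_dy, Sf.
  + apply (smooth_ex_dy (dx f)), smooth_dx, Sf.
- apply (smooth_cont2 (dx (dy f))), smooth_dx, smooth_dy, Sf.
- apply (smooth_cont2 (dy (dx f))), smooth_dy, smooth_dx, Sf.
Qed.

(** The derivatives of [w] are integrated by parts; the second derivatives of [u] cancel because
    $\nabla^\perp u$ is divergence-free. *)
Lemma torus_int_poisson h u w :
  smooth h -> periodic h -> smooth u -> periodic u -> smooth w -> periodic w ->
  torus_int (fun x y => h x y * poisson w u x y) =
  torus_int (fun x y => poisson u h x y * w x y).
Proof.
intros Sh Ph Su Pu Sw Pw.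
pose proof (torus_int_dx_parts w (fun x y => h x y * dy u x y) Sw Pw
  (smooth_mult _ _ Sh (smooth_dy _ Su)) (periodic_mult _ _ Ph (periodic_dy _ Su Pu))) as H1.
pose proof (torus_int_dy_parts w (fun x y => h x y * dx u x y) Sw Pw
  (smooth_mult _ _ Sh (smooth_dx _ Su)) (periodic_mult _ _ Ph (periodic_dx _ Su Pu))) as H2.
rewrite dx_mult in H1 by (apply smooth_ex_dx; auto using smooth_dy).
rewrite dy_mult in H2 by (apply smooth_ex_dy; auto using smooth_dx).
rewrite (smooth_schwarz u Su) in H1.
replace (fun x y => h x y * poisson w u x y) with
  (fun x y => -1 * (dx w x y * (h x y * dy u x y)) + dy w x y * (h x y * dx u x y))
  by (rewrite poisson_eq; apply fun2_ext; intros; ring).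
replace (fun x y => poisson u h x y * w x y) with
  (fun x y => w x y * (dx h x y * dy u x y + h x y * dy (dx u) x y)
    + -1 * (w x y * (dy h x y * dx u x y + h x y * dy (dx u) x y)))
  by (rewrite poisson_eq; apply fun2_ext; intros; ring).
rewrite !torus_int_plus, !torus_int_scal, H1, H2;
  repeat first [apply cont2_plus | apply cont2_scal | apply cont2_mult];
  auto using smooth_cont2, smooth_dx, smooth_dy.
ring.
Qed.

(** With $\Lambda=(-\Delta)^{1/2}$, self-adjointness turns the two inner products into $\int(\Lambda
    a)\,w$ and $\int(\Lambda v)\{w,u\}=\int\{u,\Lambda v\}\,w$. Hence $\Lambda a=\{u,\Lambda v\}$
    suffices. *)
Lemma is_adstar_intro u v Lv a M :
  smooth u -> periodic u ->
  has_half_laplacian v Lv -> (forall x y, Rabs (v x y) <= M) ->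
  smooth Lv -> periodic Lv ->
  in_lie_algebra a -> (forall x y, Rabs (a x y) <= M) ->
  has_half_laplacian a (poisson u Lv) ->
  is_adstar u v a.
Proof.
intros Su Pu Hv Bv SL PL Ha Ba HLa; split; [exact Ha|].
intros w (Sw & Pw & _); unfold inner, ad.
rewrite (half_laplacian_selfadjoint _ _ _ _ HLa Ba Sw Pw).
rewrite (half_laplacian_selfadjoint _ _ _ _ Hv Bv);
  [|apply smooth_poisson; assumption | apply periodic_poisson; assumption].
symmetry; apply torus_int_poisson; assumption.
Qed.

(** * Modes as Lie algebra elements, and uniqueness of the coadjoint coefficients *)

Lemma symbol_pos m n : (m, n) <> (0, 0)%Z -> 0 < symbol m n.
Proof.
intros H; apply sqrt_lt_R0.
destruct (Z.eq_dec m 0) as [->|Hm].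
- assert (Hn : n <> 0%Z) by congruence.
  pose proof (pow2_gt_0 _ (freq_neq_0 n Hn)); pose proof (pow2_ge_0 (freq 0)); lra.
- pose proof (pow2_gt_0 _ (freq_neq_0 m Hm)); pose proof (pow2_ge_0 (freq n)); lra.
Qed.

Lemma is_zero_pair m n : (m, n) <> (0, 0)%Z -> is_zero m * is_zero n = 0.
Proof.
intros H; unfold is_zero.
destruct (Z.eqb_spec m 0) as [->|], (Z.eqb_spec n 0) as [->|]; try ring.
congruence.
Qed.

Lemma in_lie_algebra_mode m n phi :
  (m, n) <> (0, 0)%Z -> in_lie_algebra (mode m n phi).
Proof.
intros H; repeat split; try apply smooth_mode; try apply periodic_mode.
rewrite torus_int_mode, is_zero_pair by exact H; ring.
Qed.

Lemma in_lie_algebra_plus f g :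
  in_lie_algebra f -> in_lie_algebra g -> in_lie_algebra (fun x y => f x y + g x y).
Proof.
intros (Sf & Pf & If) (Sg & Pg & Ig); split; [apply smooth_plus; assumption|].
split; [apply periodic_plus; assumption|].
rewrite torus_int_plus, If, Ig by (apply smooth_cont2; assumption); ring.
Qed.

Lemma in_lie_algebra_scal c f :
  in_lie_algebra f -> in_lie_algebra (fun x y => c * f x y).
Proof.
intros (Sf & Pf & If); split; [apply smooth_scal; assumption|].
split; [apply periodic_scal; assumption|].
rewrite torus_int_scal, If by (apply smooth_cont2; assumption); ring.
Qed.

Lemma in_lie_algebra_cont2 f : in_lie_algebra f -> cont2 f.
Proof. intros (Sf & _); apply smooth_cont2, Sf. Qed.

(** The inner product with a mode of nonzero frequency is the coefficient times a positive symbol,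
    and both candidates have the same inner products. *)
Lemma is_adstar_mode_coef u v a a' : is_adstar u v a -> is_adstar u v a' ->
  forall m n phi, mode_coef a m n phi = mode_coef a' m n phi.
Proof.
intros [La Ha] [La' Ha'] m n phi.
destruct (Z.eq_dec m 0) as [Hm|Hm], (Z.eq_dec n 0) as [Hn|Hn].
(* A constant is not an admissible test function; here the mean-zero condition makes both
   coefficients vanish. *)
1: { subst m n.
  assert (H0 : forall f, in_lie_algebra f -> mode_coef f 0 0 phi = 0).
  { intros f Hf; unfold mode_coef.
    replace (fun x y => _) with (fun x y => cos phi * f x y).
    - apply in_lie_algebra_scal, Hf.
    - apply fun2_ext; intros x y; unfold mode, phase, freq.
      rewrite Rmult_comm; f_equal; f_equal; ring. }
  rewrite !H0 by assumption; reflexivity. }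
all: assert (Hmn : (m, n) <> (0, 0)%Z) by congruence.
all: pose proof (in_lie_algebra_mode m n phi Hmn) as Hw.
all: assert (E : inner a (mode m n phi) = inner a' (mode m n phi))
  by (rewrite (Ha _ Hw), (Ha' _ Hw); reflexivity).
all: assert (HI : forall f, in_lie_algebra f ->
  inner f (mode m n phi) = symbol m n * mode_coef f m n phi)
  by (intros f Hf; unfold inner;
    rewrite (half_laplacian_eq _ _ (has_half_laplacian_mode m n phi));
    unfold mode_coef; rewrite <- torus_int_scal
      by (apply cont2_mult_mode, in_lie_algebra_cont2, Hf);
    f_equal; apply fun2_ext; intros; ring).
all: rewrite !HI in E by assumption; pose proof (symbol_pos m n Hmn).
all: apply Rmult_eq_reg_l in E; [exact E | lra].
Qed.

Lemma half_laplacian_ext f g : cont2 f -> cont2 g ->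
  (forall m n phi, mode_coef f m n phi = mode_coef g m n phi) ->
  half_laplacian f = half_laplacian g.
Proof.
intros Cf Cg H; apply fun2_ext; intros x y.
rewrite !half_laplacian_psum by assumption; f_equal; apply Lim_seq_ext; intros N.
apply sum_Z2_ext; intros m n; rewrite !H; reflexivity.
Qed.

Lemma adstar_spec u v a : is_adstar u v a -> is_adstar u v (adstar u v).
Proof. intros H; unfold adstar; apply epsilon_spec; exists a; exact H. Qed.

(** Replaces the function chosen by [epsilon] with an explicit one under [half_laplacian], which
    sees Fourier coefficients only. Combinations are allowed because Arnold's formula contains a sum
    and a difference of [adstar] terms. *)
Lemma half_laplacian_adstar_combination c c' u v a u' v' a' :
  is_adstar u v a -> is_adstar u' v' a' ->
  half_laplacian (fun x y => c * adstar u v x y + c' * adstar u' v' x y) =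
  half_laplacian (fun x y => c * a x y + c' * a' x y).
Proof.
intros H H'.
pose proof (adstar_spec _ _ _ H) as Hs; pose proof (adstar_spec _ _ _ H') as Hs'.
assert (C1 : cont2 a) by apply in_lie_algebra_cont2, H.
assert (C2 : cont2 a') by apply in_lie_algebra_cont2, H'.
assert (C3 : cont2 (adstar u v)) by apply in_lie_algebra_cont2, Hs.
assert (C4 : cont2 (adstar u' v')) by apply in_lie_algebra_cont2, Hs'.
apply half_laplacian_ext; auto using cont2_plus, cont2_scal.
intros m n phi; rewrite !mode_coef_plus, !mode_coef_scal; auto using cont2_scal.
rewrite (is_adstar_mode_coef _ _ _ _ H Hs), (is_adstar_mode_coef _ _ _ _ H' Hs').
reflexivity.
Qed.

(** * Curvature of two modes of equal length *)

Lemma torus_int_mode_sq m n : (m, n) <> (0, 0)%Z ->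
  torus_int (fun x y => mode m n 0 x y * mode m n 0 x y) = / 2.
Proof.
intros H; rewrite torus_int_mode_mult, !Z.sub_diag.
rewrite (is_zero_pair (m + m) (n + n)).
- rewrite Rminus_0_r, cos_0; unfold is_zero; simpl; ring.
- intros E; apply H; injection E; intros; f_equal; lia.
Qed.

Lemma torus_int_mode_orthogonal m n m' n' :
  (m - m', n - n')%Z <> (0, 0)%Z -> (m + m', n + n')%Z <> (0, 0)%Z ->
  torus_int (fun x y => mode m n 0 x y * mode m' n' 0 x y) = 0.
Proof.
intros H1 H2; rewrite torus_int_mode_mult, !is_zero_pair by assumption; ring.
Qed.

Lemma mode_bounded m n phi x y : Rabs (mode m n phi x y) <= 1.
Proof. apply Rabs_le; unfold mode; apply COS_bound. Qed.

Section TwoModes.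

Variables p1 p2 q1 q2 : Z.
Hypothesis Hp : (p1, p2) <> (0, 0)%Z.
Hypothesis Hq : (q1, q2) <> (0, 0)%Z.
(** Together with the next hypothesis this excludes $q=\pm p$: both modes of the bracket have
    nonzero frequency, so $(-\Delta)^{1/2}$ can be inverted on them. *)
Hypothesis Hadd : (p1 + q1, p2 + q2)%Z <> (0, 0)%Z.
Hypothesis Hsub : (p1 - q1, p2 - q2)%Z <> (0, 0)%Z.
Hypothesis Hlength : symbol p1 p2 = symbol q1 q2.

Let lambda := symbol p1 p2.
(** The cross product $p\times q$ of the frequency vectors. *)
Let c := freq p1 * freq q2 - freq p2 * freq q1.
Let sa := symbol (p1 + q1) (p2 + q2).
Let ss := symbol (p1 - q1) (p2 - q2).
Let u := mode p1 p2 0.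
Let v := mode q1 q2 0.

(** The plane that contains both $\{u,v\}$ and $\mathrm{ad}^*_uv$; on it $(-\Delta)^{1/2}$ is
    diagonal with entries [sa] and [ss]. *)
Definition sum_diff_modes (a b x y : R) : R :=
  a * mode (p1 + q1) (p2 + q2) 0 x y + b * mode (p1 - q1) (p2 - q2) 0 x y.

Lemma has_half_laplacian_sum_diff a b :
  has_half_laplacian (sum_diff_modes a b) (sum_diff_modes (a * sa) (b * ss)).
Proof.
replace (sum_diff_modes (a * sa) (b * ss)) with
  (fun x y => a * (sa * mode (p1 + q1) (p2 + q2) 0 x y)
    + b * (ss * mode (p1 - q1) (p2 - q2) 0 x y))
  by (apply fun2_ext; intros; unfold sum_diff_modes; ring).
apply has_half_laplacian_plus; apply has_half_laplacian_scal, has_half_laplacian_mode.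
Qed.

Lemma in_lie_algebra_sum_diff a b : in_lie_algebra (sum_diff_modes a b).
Proof.
apply in_lie_algebra_plus; apply in_lie_algebra_scal, in_lie_algebra_mode; assumption.
Qed.

(** The summand 1 lets the same constant bound a single mode too, as [is_adstar_intro] asks for one
    common bound. *)
Lemma sum_diff_bounded a b x y : Rabs (sum_diff_modes a b x y) <= 1 + Rabs a + Rabs b.
Proof.
unfold sum_diff_modes; eapply Rle_trans; [apply Rabs_triang|].
rewrite !Rabs_mult.
pose proof (mode_bounded (p1 + q1) (p2 + q2) 0 x y).
pose proof (mode_bounded (p1 - q1) (p2 - q2) 0 x y).
pose proof (Rabs_pos a); pose proof (Rabs_pos b).
nra.
Qed.

Lemma sum_diff_scal k a b :
  (fun x y => k * sum_diff_modes a b x y) = sum_diff_modes (k * a) (k * b).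
Proof. apply fun2_ext; intros; unfold sum_diff_modes; ring. Qed.

Lemma torus_int_sum_diff_mult a b a' b' :
  torus_int (fun x y => sum_diff_modes a b x y * sum_diff_modes a' b' x y) =
  (a * a' + b * b') / 2.
Proof.
set (M := mode (p1 + q1) (p2 + q2) 0); set (M' := mode (p1 - q1) (p2 - q2) 0).
replace (fun x y => sum_diff_modes a b x y * sum_diff_modes a' b' x y) with
  (fun x y => a * a' * (M x y * M x y) + (b * b' * (M' x y * M' x y)
    + (a * b' + b * a') * (M x y * M' x y)))
  by (apply fun2_ext; intros; unfold sum_diff_modes; fold M M'; ring).
rewrite !torus_int_plus, !torus_int_scal;
  repeat first [apply cont2_plus | apply cont2_scal | apply cont2_mult | apply cont2_mode].
(* The frequencies $p+q$ and $p-q$ have sum $2p$ and difference $2q$, both nonzero, so the two modes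
   are orthogonal. *)
unfold M, M'; rewrite !torus_int_mode_sq, torus_int_mode_orthogonal by
  first [assumption
    | intros E; apply Hq; injection E; intros; f_equal; lia
    | intros E; apply Hp; injection E; intros; f_equal; lia].
field.
Qed.

(** Both sides equal $-c\sin(p\cdot x)\sin(q\cdot x)$. *)
Lemma poisson_modes : poisson u v = sum_diff_modes (c / 2) (- (c / 2)).
Proof.
rewrite poisson_eq; unfold u, v; rewrite !dx_mode, !dy_mode.
apply fun2_ext; intros x y; unfold sum_diff_modes.
replace (mode (p1 - q1) (p2 - q2) 0 x y) with
  (cos (phase p1 p2 x y - phase q1 q2 x y))
  by (unfold mode, phase; rewrite !freq_minus; f_equal; ring).
replace (mode (p1 + q1) (p2 + q2) 0 x y) with
  (cos (phase p1 p2 x y + phase q1 q2 x y))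
  by (unfold mode, phase; rewrite !freq_plus; f_equal; ring).
unfold mode; rewrite !Rplus_0_l, !cos_plus_PI2, cos_plus, cos_minus.
unfold c; field.
Qed.

Lemma sa_pos : 0 < sa.
Proof. apply symbol_pos, Hadd. Qed.

Lemma ss_pos : 0 < ss.
Proof. apply symbol_pos, Hsub. Qed.

(** This is $\lambda(-\Delta)^{-1/2}\{u,v\}$: the inverse divides the two coefficients by [sa] and
    [ss]. *)
Let a0 := sum_diff_modes (lambda * (c / 2) / sa) (lambda * - (c / 2) / ss).

Lemma has_half_laplacian_u : has_half_laplacian u (fun x y => lambda * u x y).
Proof. apply has_half_laplacian_mode. Qed.

(** Equal length of the frequencies gives [v] the same eigenvalue as [u]. *)
Lemma has_half_laplacian_v : has_half_laplacian v (fun x y => lambda * v x y).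
Proof. unfold lambda; rewrite Hlength; apply has_half_laplacian_mode. Qed.

Lemma has_half_laplacian_a0 :
  has_half_laplacian a0 (fun x y => lambda * poisson u v x y).
Proof.
rewrite poisson_modes, sum_diff_scal.
replace (lambda * (c / 2)) with (lambda * (c / 2) / sa * sa)
  by (pose proof sa_pos; field; lra).
replace (lambda * - (c / 2)) with (lambda * - (c / 2) / ss * ss)
  by (pose proof ss_pos; field; lra).
pose proof (has_half_laplacian_sum_diff (lambda * (c / 2) / sa) (lambda * - (c / 2) / ss)) as H.
exact H.
Qed.

(** As [g] has eigenvalue [lambda], the bracket of [f] with its half-Laplacian is [k * lambda] times
    $\{u,v\}$, the half-Laplacian of [k * a0]. The values 1, -1 and 0 of [k] serve the pairs
    $(u,v)$, $(v,u)$ and $(v,v)$. *)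
Lemma is_adstar_modes f g k :
  smooth f -> periodic f ->
  has_half_laplacian g (fun x y => lambda * g x y) ->
  (forall x y, Rabs (g x y) <= 1) -> smooth g -> periodic g ->
  poisson f g = (fun x y => k * poisson u v x y) ->
  is_adstar f g (fun x y => k * a0 x y).
Proof.
intros Sf Pf Hg Bg Sg Pg E.
assert (HL : has_half_laplacian (fun x y => k * a0 x y)
  (poisson f (fun x y => lambda * g x y))).
{ rewrite poisson_scal_r, E.
  replace (fun x y => lambda * (k * poisson u v x y))
    with (fun x y => k * (lambda * poisson u v x y)) by (apply fun2_ext; intros; ring).
  apply has_half_laplacian_scal, has_half_laplacian_a0. }
revert HL; unfold a0; rewrite sum_diff_scal; intros HL.
eapply (is_adstar_intro f g _ _ _ Sf Pf Hg _ (smooth_scal _ _ Sg) (periodic_scal _ _ Pg)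
  (in_lie_algebra_sum_diff _ _) (sum_diff_bounded _ _) HL).
Unshelve.
intros x y; eapply Rle_trans; [apply Bg|].
match goal with |- 1 <= 1 + Rabs ?a + Rabs ?b =>
  pose proof (Rabs_pos a); pose proof (Rabs_pos b); lra end.
Qed.

Lemma inner_two_modes : normsq u = lambda / 2 /\ normsq v = lambda / 2 /\ inner u v = 0.
Proof.
assert (H : forall f g, cont2 f -> has_half_laplacian g (fun x y => lambda * g x y) ->
  inner f g = lambda * torus_int (fun x y => f x y * g x y)).
{ intros f g Cf Hg; unfold inner; rewrite (half_laplacian_eq _ _ Hg).
  rewrite <- torus_int_scal by (apply cont2_mult; [exact Cf | apply Hg]).
  f_equal; apply fun2_ext; intros; ring. }
unfold normsq; rewrite !H;
  try apply cont2_mode; auto using has_half_laplacian_u, has_half_laplacian_v.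
unfold u, v; rewrite !torus_int_mode_sq, torus_int_mode_orthogonal by assumption.
repeat split; field.
Qed.

(** Integrating a linear relation against [u] and [v] isolates $a/2$ and $b/2$ by orthogonality. *)
Lemma lin_indep_modes : lin_indep u v.
Proof.
intros a b H.
assert (Huv : forall f, cont2 f ->
  a * torus_int (fun x y => u x y * f x y) + b * torus_int (fun x y => v x y * f x y) = 0).
{ intros f Cf.
  rewrite <- !torus_int_scal, <- torus_int_plus
    by (repeat first [apply cont2_scal | apply cont2_mult | apply cont2_mode | exact Cf]).
  rewrite <- (torus_int_const 0); f_equal; apply fun2_ext; intros x y.
  rewrite <- (Rmult_0_l (f x y)), <- (H x y); ring. }
pose proof (Huv u (cont2_mode _ _ _)) as H1; pose proof (Huv v (cont2_mode _ _ _)) as H2.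
unfold u, v in H1, H2.
rewrite torus_int_mode_sq, torus_int_mode_orthogonal in H1; try assumption.
- rewrite torus_int_mode_sq, torus_int_mode_orthogonal in H2 by assumption; lra.
- intros E; apply Hsub; injection E; intros; f_equal; lia.
- intros E; apply Hadd; injection E; intros; f_equal; lia.
Qed.

(** The first two terms of Arnold's formula vanish, as $\mathrm{ad}^*_vu=-\mathrm{ad}^*_uv$ and
    $\mathrm{ad}^*_vv=0$ up to Fourier coefficients. The others give $-\tfrac{3}{32}c^2(s_a+s_s)$
    and $\tfrac14\lambda c^2$, where $s_a$, $s_s$ stand for [sa], [ss]; the denominator is
    $\lambda^2/4$. *)
Lemma sectional_curvature_modes :
  sectional_curvature u v = c ^ 2 / lambda ^ 2 * (lambda - 3 / 8 * (sa + ss)).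
Proof.
assert (Su : smooth u) by apply smooth_mode.
assert (Sv : smooth v) by apply smooth_mode.
assert (Pu : periodic u) by apply periodic_mode.
assert (Pv : periodic v) by apply periodic_mode.
assert (Bu : forall x y, Rabs (u x y) <= 1) by apply mode_bounded.
assert (Bv : forall x y, Rabs (v x y) <= 1) by apply mode_bounded.
assert (Huv : is_adstar u v (fun x y => 1 * a0 x y)).
{ apply is_adstar_modes; auto using has_half_laplacian_v.
  apply fun2_ext; intros; ring. }
assert (Hvu : is_adstar v u (fun x y => -1 * a0 x y)).
{ apply is_adstar_modes; auto using has_half_laplacian_u, poisson_antisym. }
assert (Hself : forall f, poisson f f = (fun x y => 0 * poisson u v x y)).
{ intros f; rewrite (poisson_eq f f); apply fun2_ext; intros; ring. }
assert (Hvv : is_adstar v v (fun x y => 0 * a0 x y))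
  by (apply is_adstar_modes; auto using has_half_laplacian_v).
assert (HL : forall b b' k k' f g f' g',
  is_adstar f g (fun x y => k * a0 x y) -> is_adstar f' g' (fun x y => k' * a0 x y) ->
  half_laplacian (fun x y => b * adstar f g x y + b' * adstar f' g' x y) =
  (fun x y => (b * k + b' * k') * (lambda * poisson u v x y))).
{ intros b b' k k' f g f' g' H H'.
  rewrite (half_laplacian_adstar_combination _ _ _ _ _ _ _ _ H H').
  apply half_laplacian_eq.
  replace (fun x y => b * (k * a0 x y) + b' * (k' * a0 x y))
    with (fun x y => (b * k + b' * k') * a0 x y) by (apply fun2_ext; intros; ring).
  apply has_half_laplacian_scal, has_half_laplacian_a0. }
assert (L1 : half_laplacian (fadd (adstar v u) (adstar u v)) = fun _ _ => 0).
{ replace (fadd (adstar v u) (adstar u v))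
    with (fun x y => 1 * adstar v u x y + 1 * adstar u v x y)
    by (apply fun2_ext; intros; unfold fadd; ring).
  rewrite (HL _ _ _ _ _ _ _ _ Hvu Huv); apply fun2_ext; intros; ring. }
assert (L2 : half_laplacian (adstar v v) = fun _ _ => 0).
(* A single [adstar] is read as a combination whose second coefficient is zero. *)
{ replace (adstar v v) with (fun x y => 1 * adstar v v x y + 0 * adstar v v x y)
    by (apply fun2_ext; intros; ring).
  rewrite (HL _ _ _ _ _ _ _ _ Hvv Hvv); apply fun2_ext; intros; ring. }
assert (L3 : half_laplacian (fsub (adstar v u) (adstar u v)) =
  sum_diff_modes (-2 * lambda * (c / 2)) (-2 * lambda * - (c / 2))).
{ replace (fsub (adstar v u) (adstar u v))
    with (fun x y => 1 * adstar v u x y + -1 * adstar u v x y)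
    by (apply fun2_ext; intros; unfold fsub; ring).
  rewrite (HL _ _ _ _ _ _ _ _ Hvu Huv), poisson_modes.
  apply fun2_ext; intros; unfold sum_diff_modes; ring. }
assert (Had : ad u v = sum_diff_modes (-1 * (c / 2)) (-1 * - (c / 2))).
{ unfold ad; rewrite poisson_antisym, poisson_modes; apply sum_diff_scal. }
(* In the first two terms [adstar] also occurs outside [half_laplacian]; there the other factor is
   zero, whatever function was chosen. *)
assert (Hz : forall f, torus_int (fun x y => f x y * 0) = 0).
{ intros f; rewrite <- (torus_int_const 0) at 1; f_equal; apply fun2_ext; intros; ring. }
destruct inner_two_modes as (Nu & Nv & Iuv).
unfold sectional_curvature, unnormalized_curvature.
rewrite Nu, Nv, Iuv; unfold normsq, inner; rewrite L1, L2, L3, Had, !Hz.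
rewrite (half_laplacian_eq _ _ (has_half_laplacian_sum_diff _ _)).
rewrite !torus_int_sum_diff_mult.
assert (0 < lambda) by (apply symbol_pos, Hp).
field; lra.
Qed.

End TwoModes.

(** * Explicit frequencies and their dilations *)

Lemma symbol_eq m n r : 0 <= r -> freq m ^ 2 + freq n ^ 2 = r ^ 2 -> symbol m n = r.
Proof. intros Hr H; unfold symbol; rewrite H; apply sqrt_pow2, Hr. Qed.

Lemma freq_mult j k : freq (j * k) = IZR j * freq k.
Proof. unfold freq; rewrite mult_IZR; ring. Qed.

Lemma pair_neq_0 (m n : Z) : m <> 0%Z \/ n <> 0%Z -> (m, n) <> (0, 0)%Z.
Proof. intros H E; injection E; tauto. Qed.

Lemma exists_large_freq C : exists k, (0 < k)%Z /\ 1 <= freq k /\ C < freq k.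
Proof.
pose proof PI2_1.
(* [up C] exceeds [C], the maximum with 1 ensures positivity, and the factor $2\pi$ only enlarges
   the frequency. *)
exists (Z.max 1 (up C)); assert (1 <= IZR (Z.max 1 (up C))) by (apply (IZR_le 1); lia).
assert (IZR (up C) <= IZR (Z.max 1 (up C))) by (apply IZR_le; lia).
destruct (archimed C) as [HC _].
unfold freq; repeat split; [lia | nra | nra].
Qed.

Lemma cube_ge t : 1 <= t -> t <= t ^ 3.
Proof. intros Ht; nra. Qed.

Theorem theorem5p1 :
  (forall C : R, 0 < C ->
     exists u v : R -> R -> R,
       in_lie_algebra u /\ in_lie_algebra v /\ lin_indep u v /\
       sectional_curvature u v > C) /\
  (forall C : R, 0 < C ->
     exists u' v' : R -> R -> R,
       in_lie_algebra u' /\ in_lie_algebra v' /\ lin_indep u' v' /\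
       sectional_curvature u' v' < - C).
Proof.
split; intros C HC.
(* Positive curvature: $p=k(5,0)$ and $q=k(4,3)$ have length $5t$, while $p+q=k(9,3)$ and
   $p-q=k(1,-3)$ have lengths $3\sqrt{10}\,t$ and $\sqrt{10}\,t$. *)
- destruct (exists_large_freq C) as (k & Hk & H1 & HkC).
  set (t := freq k) in *.
  assert (E1 : symbol (5 * k) 0 = 5 * t).
  { apply symbol_eq; [lra|].
    (* The type ascription reads the product of zeros as 0, which exhibits [freq 0] as a multiple of
       zero for [ring]. *)
    rewrite (freq_mult 5), (freq_mult 0 0 : freq 0 = _); fold t; ring. }
  assert (E2 : symbol (4 * k) (3 * k) = 5 * t).
  { apply symbol_eq; [lra|]; rewrite !freq_mult; fold t; ring. }
  assert (H10 : 0 <= sqrt 10) by apply sqrt_pos.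
  assert (Q10 : sqrt 10 ^ 2 = 10) by (apply pow2_sqrt; lra).
  assert (E3 : symbol (5 * k + 4 * k) (0 + 3 * k) = 3 * sqrt 10 * t).
  { replace (5 * k + 4 * k)%Z with (9 * k)%Z by ring.
    apply symbol_eq; [apply Rmult_le_pos; lra|]; rewrite Z.add_0_l, !freq_mult; fold t.
    rewrite !Rpow_mult_distr, Q10; ring. }
  assert (E4 : symbol (5 * k - 4 * k) (0 - 3 * k) = sqrt 10 * t).
  { replace (5 * k - 4 * k)%Z with (1 * k)%Z by ring.
    replace (0 - 3 * k)%Z with ((-3) * k)%Z by ring.
    apply symbol_eq; [apply Rmult_le_pos; lra|]; rewrite !freq_mult; fold t.
    rewrite !Rpow_mult_distr, Q10; ring. }
  assert (N1 : (5 * k, 0)%Z <> (0, 0)%Z) by (apply pair_neq_0; lia).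
  assert (N2 : (4 * k, 3 * k)%Z <> (0, 0)%Z) by (apply pair_neq_0; lia).
  assert (N3 : (5 * k + 4 * k, 0 + 3 * k)%Z <> (0, 0)%Z) by (apply pair_neq_0; lia).
  assert (N4 : (5 * k - 4 * k, 0 - 3 * k)%Z <> (0, 0)%Z) by (apply pair_neq_0; lia).
  exists (mode (5 * k) 0 0), (mode (4 * k) (3 * k) 0).
  split; [apply in_lie_algebra_mode, N1|].
  split; [apply in_lie_algebra_mode, N2|].
  split; [apply lin_indep_modes; assumption|].
  rewrite sectional_curvature_modes by (assumption || congruence).
  rewrite E1, E3, E4, !freq_mult, (freq_mult 0 0 : freq 0 = _); fold t.
  (* Here $c=15t^2$ and $\lambda=5t$. The bound 3.2 on $\sqrt{10}$ makes the factor of $t^3$ at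
     least 1.8, and $t^3\ge t>C$. *)
  replace (_ * _) with (t ^ 3 * (9 * (5 - 3 / 2 * sqrt 10))) by (field; lra).
  assert (sqrt 10 <= 3.2) by nra.
  pose proof (cube_ge t H1); nra.
(* Negative curvature: orthogonal $p=k(1,0)$ and $q=k(0,1)$. The factor of $t^3$ will be at most
   $1-\tfrac34\cdot 1.4=-\tfrac1{20}$, hence the 20. *)
- destruct (exists_large_freq (20 * C)) as (k & Hk & H1 & HkC).
  set (t := freq k) in *.
  assert (F0 : freq 0 = 0) by (unfold freq; ring).
  assert (E1 : symbol k 0 = t) by (apply symbol_eq; [lra|]; rewrite F0; fold t; ring).
  assert (E2 : symbol 0 k = t) by (apply symbol_eq; [lra|]; rewrite F0; fold t; ring).
  assert (H2 : 0 <= sqrt 2) by apply sqrt_pos.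
  assert (Q2 : sqrt 2 ^ 2 = 2) by (apply pow2_sqrt; lra).
  assert (E3 : symbol (k + 0) (0 + k) = sqrt 2 * t).
  { apply symbol_eq; [apply Rmult_le_pos; lra|]; rewrite Z.add_0_l, Z.add_0_r; fold t.
    rewrite Rpow_mult_distr, Q2; ring. }
  assert (E4 : symbol (k - 0) (0 - k) = sqrt 2 * t).
  { apply symbol_eq; [apply Rmult_le_pos; lra|]; rewrite Z.sub_0_r, Z.sub_0_l, freq_opp; fold t.
    rewrite Rpow_mult_distr, Q2; ring. }
  assert (N1 : (k, 0)%Z <> (0, 0)%Z) by (apply pair_neq_0; lia).
  assert (N2 : (0, k)%Z <> (0, 0)%Z) by (apply pair_neq_0; lia).
  assert (N3 : (k + 0, 0 + k)%Z <> (0, 0)%Z) by (apply pair_neq_0; lia).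
  assert (N4 : (k - 0, 0 - k)%Z <> (0, 0)%Z) by (apply pair_neq_0; lia).
  exists (mode k 0 0), (mode 0 k 0).
  split; [apply in_lie_algebra_mode, N1|].
  split; [apply in_lie_algebra_mode, N2|].
  split; [apply lin_indep_modes; assumption|].
  rewrite sectional_curvature_modes by (assumption || congruence).
  rewrite E1, E3, E4, F0; fold t.
  replace (_ * _) with (t ^ 3 * (1 - 3 / 4 * sqrt 2)) by (field; lra).
  assert (1.4 <= sqrt 2) by nra.
  pose proof (cube_ge t H1); nra.
Qed.
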